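(* Let $\beta,\gamma>0$ with $1/\gamma<\beta$, and assume that $H^2$ regularity holds on $\Omega$: for every $q\in L^2(\Omega)$ the problem $-\Delta u=q$ in $\Omega$ with zero trace on $\partial\Omega$ has a unique solution $u\in H^2_0(\Omega)$, and $\|u\|_{H^2(\Omega)}\le C\|q\|_{L^2(\Omega)}$ with $C$ independent of $q$. Let $u_d\in L^2(\Gamma)$ and $f_p\in L^2(\Omega)$. Consider the following three formulations. (a) Minimization: find $$(u,f)=\operatorname*{arg\,min}_{(v,g)\in V_\beta\times G_\beta}\ \gamma^2\|-\Delta v-g\|_{L^2(\Omega)}^2+\|v-u_d\|_{L^2(\Gamma)}^2+\beta^2\|g-f_p\|_{L^2(\Omega)}^2 .$$ (b) Variational problem: find $u\in V_\beta$, $f\in G_\beta$ such that $$(u,v)_\Gamma+\gamma^2(-\Delta u-f,-\Delta v)_\Omega=(u_d,v)_\Gamma\quad\forall v\in V_\beta,$$ $$\gamma^2(-\Delta u,-g)_\Omega+(\beta^2+\gamma^2)(f,g)_\Omega=\beta^2(f_p,g)_\Omega\quad\forall g\in G_\beta.$$ (c) Penalized Lagrangian (saddle-point) problem: find $u\in V_\beta$, $f\in G_\beta$, $\lambda\in M_\beta$ such that $$(u,v)_\Gamma+(\lambda,-\Delta v)_\Omega=(u_d,v)_\Gamma\quad\forall v\in V_\beta,$$ $$\beta^2(f,g)_\Omega+(\lambda,-g)_\Omega=\beta^2(f_p,g)_\Omega\quad\forall g\in G_\beta,$$ $$(-\Delta u-f,\mu)_\Omega-\frac1{\gamma^2}(\lambda,\mu)_\Omega=0\quad\forall\mu\in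 M_\beta.$$ Then each of these (equivalent) problems is well-posed: for all such data $(u_d,f_p)$ there exists a unique solution, namely $(u,f)\in V_\beta\times G_\beta$ for (a) and (b), and $(u,f,\lambda)\in V_\beta\times G_\beta\times M_\beta$ for (c), and the solution depends continuously, in the norms of these spaces, on $(u_d,f_p) \in L^2(\Gamma)\times L^2(\Omega)$.
   Context: $\Omega\subset\mathbb{R}^n$ is a bounded domain, and $\Gamma$ is a proper subdomain of $\Omega$ (partial observations). $(\cdot,\cdot)_X$ denotes the $L^2(X)$ inner product. $H^2_0(\Omega)$ denotes the subspace of functions in $H^2(\Omega)$ with zero trace on $\partial\Omega$ (only the function itself, not its normal derivative, is required to vanish on the boundary). Homogeneous Dirichlet boundary conditions are thus imposed exactly through the space $V_\beta$. The spaces are: - $V_\beta=L^2(\Gamma)\cap\beta H^2_0(\Omega)$, i.e. $H_0^2(\Omega)$ with the inner product $(u,v)_{V_\beta}=(u,v)_{L^2(\Gamma)}+\beta^2(\Delta u,\Delta v)_{L^2(\Omega)}$; - $G_\beta=\beta L^2(\Omega)$, i.e. $L^2(\Omega)$ with norm $\|g\|_{G_\beta}=\beta\|g\|_{L^2(\Omega)}$; - $M_\beta=\frac1\beta L^2(\Omega)$, i.e. $L^2(\Omega)$ with norm $\|\mu\|_{M_\beta}=\frac1\beta\|\mu\|_{L^2(\Omega)}$. *)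

(* Defs.v *)
From HB Require Import structures.
From mathcomp Require Import all_boot all_order all_algebra.
From mathcomp Require Import all_classical all_reals all_analysis.
Set Implicit Arguments. Unset Strict Implicit. Unset Printing Implicit Defensive.
Import Order.TTheory GRing.Theory Num.Theory.
Import numFieldNormedType.Exports.
Local Open Scope classical_set_scope.
Local Open Scope ring_scope.

Definition rV_display : measure_display.
Proof. exact: default_measure_display. Qed.

(* R^n is 'rV[R]_n, with its Borel sigma-algebra. *)
HB.instance Definition _ (R : realType) (n : nat) :=
  @isMeasurable.Build rV_display 'rV[R]_n <<s @open 'rV[R]_n >>
    (@sigma_algebra0 _ setT _) (@sigma_algebraC _ _) (@sigma_algebra_bigcup _ setT _).

Lemma rV_open_measurable (R : realType) (n : nat) (A : set 'rV[R]_n) :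
  open A -> measurable A.
Proof. by move=> oA; apply: sub_gen_smallest. Qed.

Lemma rV_open_bigcup (R : realType) (n : nat) (U : set 'rV[R]_n) : open U ->
  U = \bigcup_(p : 'rV[rat]_n * nat)
    if pselect (ball (map_mx ratr p.1 : 'rV[R]_n) p.2.+1%:R^-1 `<=` U)
    then ball (map_mx ratr p.1 : 'rV[R]_n) p.2.+1%:R^-1 else set0.
Proof.
move=> oU; apply/seteqP; split=> [x Ux|x [p _]]; last first.
  by case: pselect => // pU; exact: pU.
have /nbhs_ballP[e /= e0 xeU] : nbhs x U by exact: open_nbhs_nbhs.
have [k ke] : exists k, k.+1%:R^-1 < e / 2 :> R.
  have := near_infty_natSinv_lt (PosNum (divr_gt0 e0 (ltr0n R 2))).
  by case=> k _ /(_ k (leqnn _)); exists k.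
have k0 : (0 : R) < k.+1%:R^-1 by rewrite invr_gt0.
have /choice[q qP] i : exists q : rat, `|ratr q - x 0 i| < k.+1%:R^-1 :> R.
  have [|q] := @rat_in_itvoo R (x 0 i - k.+1%:R^-1) (x 0 i + k.+1%:R^-1).
    by rewrite ltrBlDr -addrA ltrDl addr_gt0.
  by rewrite in_itv/= => qx; exists q; rewrite ltr_distl.
exists (\row_i q i, k) => //=.
have qx : ball (map_mx ratr (\row_i q i) : 'rV[R]_n) k.+1%:R^-1 x.
  by split=> // i j; rewrite !mxE (ord1 i); exact: qP.
case: pselect => // -[] y qy; apply: xeU.
have := ball_triangle (ball_sym qx) qy.
by apply: le_ball; rewrite ltW// [ltRHS]splitr ltrD.
Qed.

Section cons_rV.
Context (R : realType) (n : nat).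
Definition cons_rV (p : measurableTypeR R * 'rV[R]_n) : 'rV[R]_n.+1 :=
  row_mx (const_mx p.1 : 'rV[R]_1) p.2.

Lemma cons_rV0 p : cons_rV p 0 0 = p.1.
Proof.
have -> : (0 : 'I_n.+1) = lshift n (0 : 'I_1) by exact: val_inj.
by rewrite /cons_rV (@row_mxEl _ 1 1) mxE.
Qed.

Lemma cons_rVS p j : cons_rV p 0 (lift 0 j) = p.2 0 j.
Proof.
have -> : lift 0 j = rshift 1 j by exact: val_inj.
by rewrite /cons_rV (@row_mxEr _ 1 1).
Qed.

Lemma measurable_cons_rV : measurable_fun [set: measurableTypeR R * 'rV[R]_n] cons_rV.
Proof.
apply: (@measurability _ _ _ _ _ _ (@open 'rV[R]_n.+1)) => [//|_ [U oU <-]].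
rewrite setTI (rV_open_bigcup oU) preimage_bigcup.
apply: countable_bigcupT_measurable => //= p.
case: pselect => [_a|_a] /=; last by rewrite preimage_set0; exact: measurable0.
have e0 : (0 : R) < p.2.+1%:R^-1 by rewrite invr_gt0.
rewrite (_ : _ @^-1` _ =
  (ball (ratr (p.1 0 0) : R) p.2.+1%:R^-1) `*`
  (ball (map_mx ratr (\row_j p.1 0 (lift 0 j)) : 'rV[R]_n) p.2.+1%:R^-1)).
  apply: measurableX; last by apply: rV_open_measurable; exact: ball_open.
  by apply: measurable_realfun.open_measurable; exact: ball_open.
apply/seteqP; split => [[t y] [_ ty]|[t y] [/= ht [_ hy]]].
  split=> [|/=]; last split=> // i j.
    by have := ty 0 0; rewrite cons_rV0 mxE.
  by have := ty 0 (lift 0 j); rewrite cons_rVS !mxE (ord1 i).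
split=> // i j; rewrite (ord1 i) mxE; case: (unliftP 0 j) => [k ->|->].
  by rewrite cons_rVS; have := hy 0 k; rewrite !mxE.
by rewrite cons_rV0.
Qed.

Definition uncons_rV (x : 'rV[R]_n.+1) : measurableTypeR R * 'rV[R]_n :=
  (x 0 0, rsubmx (x : 'rV_(1 + n))).

Lemma cons_rVK : cancel cons_rV uncons_rV.
Proof. by move=> [t y]; rewrite /uncons_rV cons_rV0 /cons_rV row_mxKr. Qed.

Lemma measurable_uncons_rV : measurable_fun setT uncons_rV.
Proof.
apply/measurable_fun_pairP; split.
  apply: (measurability _ (measurable_realfun.RGenOpens.measurableE R)) => _ [U [a [b ->]] <-].
  rewrite setTI; apply: rV_open_measurable; apply: open_comp => // x _.
  exact: coord_continuous.
apply: (@measurability _ _ _ _ _ _ (@open 'rV[R]_n)) => [//|_ [U oU <-]].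
rewrite setTI; apply: rV_open_measurable; apply: open_comp => // x _ /=.
move=> W /nbhs_ballP[e e0 eW]; apply/nbhs_ballP; exists e => //= y [_ xy].
by apply: eW; split=> // i j; rewrite !mxE; exact: xy.
Qed.

Context (m : {sigma_finite_measure set 'rV[R]_n -> \bar R}).

Definition cons_measure : set 'rV[R]_n.+1 -> \bar R :=
  pushforward (@lebesgue_measure R \x m)%E cons_rV.

Let cons_measure0 : cons_measure set0 = 0%E.
Proof. by rewrite /cons_measure /pushforward preimage_set0 measure0. Qed.

Let cons_measure_ge0 A : (0 <= cons_measure A)%E.
Proof. by rewrite /cons_measure /pushforward. Qed.

Let cons_measure_sigma_additive : semi_sigma_additive cons_measure.
Proof.
pose nu : {measure set 'rV[R]_n.+1 -> \bar R} :=
  measure_function_pushforward__canonical__measure_function_Measure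
    (@lebesgue_measure R \x m)%E measurable_cons_rV.
exact: (@measure_semi_sigma_additive _ _ _ nu).
Qed.

HB.instance Definition _ := isMeasure.Build _ _ _ cons_measure
  cons_measure0 cons_measure_ge0 cons_measure_sigma_additive.
Let cons_measure_sigma_finite : sigma_finite setT cons_measure.
Proof.
have /sigma_finiteP[F [TF ndF mF]] := sigma_finiteT (@lebesgue_measure R).
have /sigma_finiteP[G [TG ndG mG]] := sigma_finiteT m.
exists (fun k => uncons_rV @^-1` (F k `*` G k)) => [|k].
  rewrite -preimage_bigcup -[LHS](preimage_setT uncons_rV); congr (_ @^-1` _).
  rewrite -setXTT TF TG; apply/seteqP; split=> -[x y].
    move=> [/= [i _ Fx] [j _ Gy]]; exists (maxn i j) => //; split.
    - by move: Fx; exact/subsetPset/ndF/leq_maxl.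
    - by move: Gy; exact/subsetPset/ndG/leq_maxr.
  by move=> [k _ [Fx Gy]]; split; exists k.
have [mFk Fk] := mF k; have [mGk Gk] := mG k.
have mFG : measurable (F k `*` G k) by exact: measurableX.
split; first by rewrite -[X in measurable X]setTI; exact: measurable_uncons_rV.
rewrite /cons_measure /pushforward -comp_preimage.
rewrite (_ : _ @^-1` _ = F k `*` G k); last first.
  by apply/seteqP; split => p; rewrite /preimage /comp /mkset cons_rVK.
by rewrite product_measure1E// lte_mul_pinfty// ge0_fin_numE.
Qed.

HB.instance Definition _ := Measure_isSigmaFinite.Build _ _ _ cons_measure
  cons_measure_sigma_finite.
End cons_rV.

(* n-dimensional Lebesgue measure, as the iterated product of the
   one-dimensional one, transported along R * R^n -> R^(n+1). *)
Fixpoint lebesgue_rV (R : realType) (n : nat) :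
    {sigma_finite_measure set 'rV[R]_n -> \bar R} :=
  if n is k.+1 then cons_measure (lebesgue_rV R k) else \d_(0 : 'rV[R]_0).

Lemma lebesgue_rV_box (R : realType) (n : nat) (a b : 'rV[R]_n) :
  (forall i, a 0 i <= b 0 i) ->
  lebesgue_rV R n [set x | forall i, a 0 i < x 0 i < b 0 i] =
  (\prod_i (b 0 i - a 0 i))%:E.
Proof.
elim: n a b => [|n IH] a b ab.
  by rewrite big_ord0 /= diracE mem_set//= => -[].
rewrite big_ord_recl EFinM /= /cons_measure /pushforward.
pose a' : 'rV[R]_n := \row_j a 0 (lift 0 j).
pose b' : 'rV[R]_n := \row_j b 0 (lift 0 j).
have mbox : measurable [set y : 'rV[R]_n | forall i, a' 0 i < y 0 i < b' 0 i].
  have -> : [set y : 'rV[R]_n | forall i, a' 0 i < y 0 i < b' 0 i] =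
      \bigcap_(i in [set: 'I_n]) (fun y => y 0 i) @^-1` `]a' 0 i, b' 0 i[.
    apply/seteqP; split => y /= h i; last by have := h i I; rewrite /= in_itv.
    by move=> _; rewrite /= in_itv; exact: h.
  apply: fin_bigcap_measurable; first exact: finite_finset.
  move=> i _; apply: rV_open_measurable; apply: open_comp => [y _|]; first exact: coord_continuous.
  exact: interval_open.
rewrite (_ : _ @^-1` _ = `]a 0 0, b 0 0[%classic `*`
    [set y : 'rV[R]_n | forall i, a' 0 i < y 0 i < b' 0 i]); last first.
  apply/seteqP; split => -[t y].
    move=> h; split=> /= [|j].
      by have := h 0; rewrite cons_rV0 in_itv.
    by have := h (lift 0 j); rewrite cons_rVS !mxE.
  move=> [/= ht hy] i; case: (unliftP 0 i) => [j ->|->].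
    by rewrite cons_rVS; have := hy j; rewrite !mxE.
  by rewrite cons_rV0; move: ht; rewrite in_itv.
rewrite product_measure1E// IH => [|i]; last by rewrite !mxE.
congr (_ * _)%E; last by congr EFin; apply: eq_bigr => i _; rewrite !mxE.
apply: (etrans (@lebesgue_measure_itv R `]a 0 0, b 0 0[)).
rewrite /= lte_fin.
case: ltP => // ba; rewrite (_ : b 0 0 = a 0 0) ?subrr//.
by apply/eqP; rewrite eq_le ba ab.
Qed.

Section domains.
Context (R : realType) (n : nat).

Record domain := Domain {
  domain_set :> set 'rV[R]_n ;
  domain_open : open domain_set ;
  domain_connected : connected domain_set ;
  domain_neq0 : domain_set !=set0 }.

Definition lebesgue_on (D : domain) : set 'rV[R]_n -> \bar R :=
  mrestr (lebesgue_rV R n) (rV_open_measurable (@domain_open D)).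

HB.instance Definition _ (D : domain) := Measure.on (lebesgue_on D).

(* Elements of [L2 D] are Borel functions on all of R^n that are
   square-integrable on D; their values outside D are irrelevant. They are not
   quotiented: equality in L^2(D) is equality [%[ae lebesgue_on D]]. *)
Definition L2 (D : domain) := LfunType (lebesgue_on D) (lee1n 2).

(* The inner product and norm of L^2(D) take plain functions, so that they apply
   to functions living on a larger domain. *)
Definition L2_inner (D : domain) (u v : 'rV[R]_n -> R) : R :=
  \int[lebesgue_on D]_x (u x * v x).

Definition L2_norm (D : domain) (u : 'rV[R]_n -> R) : R :=
  Num.sqrt (L2_inner D u u).

Definition partial (i : 'I_n) (phi : 'rV[R]_n -> R) : 'rV[R]_n -> R :=
  fun x => 'D_(delta_mx 0 i : 'rV[R]_n) phi x.

(* C^oo: all iterated partial derivatives exist and are continuous. *)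
Definition smooth (phi : 'rV[R]_n -> R) : Prop :=
  forall s : seq 'I_n, continuous (foldr partial phi s) /\
    forall i x, derivable (foldr partial phi s) x (delta_mx 0 i : 'rV[R]_n).

Definition test_function (D : domain) (phi : 'rV[R]_n -> R) : Prop :=
  [/\ smooth phi, compact (closure [set x | phi x != 0]) &
      closure [set x | phi x != 0] `<=` D].

Definition weak_partial (D : domain) (i : 'I_n) (u g : L2 D) : Prop :=
  forall phi, test_function D phi ->
    L2_inner D u (partial i phi) = - L2_inner D g phi.

(* The Sobolev space H^2(D). An element carries its weak derivatives, which are
   determined almost everywhere by the function; hence equality in H^2(D) is
   almost everywhere equality of the underlying functions. *)
Record H2 (D : domain) := MkH2 {
  H2_fun : L2 D ;
  grad : 'I_n -> L2 D ;
  hess : 'I_n -> 'I_n -> L2 D ;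
  gradP : forall i, weak_partial i H2_fun (grad i) ;
  hessP : forall i j, weak_partial j (grad i) (hess i j) }.

Definition H2_to_fun (D : domain) (u : H2 D) : 'rV[R]_n -> R := H2_fun u.
Coercion H2_to_fun : H2 >-> Funclass.

Definition H2_norm (D : domain) (u : H2 D) : R :=
  Num.sqrt (L2_norm D u ^+ 2 + \sum_i L2_norm D (grad u i) ^+ 2 +
            \sum_i \sum_j L2_norm D (hess u i j) ^+ 2).

Definition lap (D : domain) (u : H2 D) : L2 D := \sum_i hess u i i.

(* u has zero trace on the boundary: u lies in H^1_0(D), the closure of the
   test functions in H^1(D). No regularity of the boundary is needed. *)
Definition zero_trace (D : domain) (u : H2 D) : Prop :=
  forall e : R, 0 < e -> exists2 phi, test_function D phi &
    L2_norm D (u \- phi) ^+ 2 +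
      \sum_i L2_norm D (grad u i \- partial i phi) ^+ 2 < e ^+ 2.

(* H^2 functions with zero trace, i.e. H^2(D) `&` H^1_0(D): the normal
   derivative is not required to vanish. *)
Record H20 (D : domain) := MkH20 {
  H20_H2 :> H2 D ;
  H20_trace : zero_trace H20_H2 }.

Definition H2_regular (D : domain) : Prop :=
  exists C : R, forall q : L2 D, exists u : H20 D,
    [/\ - lap u = q %[ae lebesgue_on D],
        (forall w : H20 D, - lap w = q %[ae lebesgue_on D] ->
           w = u %[ae lebesgue_on D]) &
        H2_norm u <= C * L2_norm D q].

End domains.

Section problems.
Context (R : realType) (n : nat) (Omega Gamma : domain R n) (beta gamma : R).

(* The norms of V_beta, G_beta, M_beta; the first one is given through the
   distance it induces. *)
Definition V_dist (u v : H20 Omega) : R :=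
  Num.sqrt (L2_norm Gamma (u \- v) ^+ 2 +
            beta ^+ 2 * L2_norm Omega (lap u - lap v) ^+ 2).

Definition G_norm (g : L2 Omega) : R := beta * L2_norm Omega g.

Definition M_norm (mu : L2 Omega) : R := beta^-1 * L2_norm Omega mu.

Local Notation V := (H20 Omega).
Local Notation G := (L2 Omega).
Local Notation M := (L2 Omega).
Local Notation data := (L2 Gamma * L2 Omega)%type.

Definition cost (d : data) (v : V) (g : G) : R :=
  gamma ^+ 2 * L2_norm Omega (- lap v - g) ^+ 2 +
  L2_norm Gamma (v \- d.1) ^+ 2 +
  beta ^+ 2 * L2_norm Omega (g - d.2) ^+ 2.

Definition minimization (d : data) (s : V * G) : Prop :=
  forall (v : V) (g : G), cost d s.1 s.2 <= cost d v g.

Definition variational (d : data) (s : V * G) : Prop :=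
  let: (ud, fp) := d in let: (u, f) := s in
  (forall v : V,
     L2_inner Gamma u v + gamma ^+ 2 * L2_inner Omega (- lap u - f) (- lap v) =
     L2_inner Gamma ud v) /\
  (forall g : G,
     gamma ^+ 2 * L2_inner Omega (- lap u) (- g) +
       (beta ^+ 2 + gamma ^+ 2) * L2_inner Omega f g =
     beta ^+ 2 * L2_inner Omega fp g).

Definition lagrangian (d : data) (s : V * G * M) : Prop :=
  let: (ud, fp) := d in let: (u, f, lambda) := s in
  [/\ forall v : V,
        L2_inner Gamma u v + L2_inner Omega lambda (- lap v) =
        L2_inner Gamma ud v,
      forall g : G,
        beta ^+ 2 * L2_inner Omega f g + L2_inner Omega lambda (- g) =
        beta ^+ 2 * L2_inner Omega fp g &
      forall mu : M,
        L2_inner Omega (- lap u - f) mu -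
          (gamma ^+ 2)^-1 * L2_inner Omega lambda mu = 0].

Definition data_dist (d d' : data) : R :=
  L2_norm Gamma (d.1 - d'.1) + L2_norm Omega (d.2 - d'.2).

Definition VG_eq (s s' : V * G) : Prop :=
  s.1 = s'.1 %[ae lebesgue_on Omega] /\ s.2 = s'.2 %[ae lebesgue_on Omega].

Definition VG_dist (s s' : V * G) : R := V_dist s.1 s'.1 + G_norm (s.2 - s'.2).

Definition VGM_eq (s s' : V * G * M) : Prop :=
  VG_eq s.1 s'.1 /\ s.2 = s'.2 %[ae lebesgue_on Omega].

Definition VGM_dist (s s' : V * G * M) : R :=
  VG_dist s.1 s'.1 + M_norm (s.2 - s'.2).

End problems.

(* Existence, uniqueness up to [eqS], and continuity of the data-to-solution
   map. *)
Definition well_posed (R : realType) (D S : Type) (distD : D -> D -> R)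
    (eqS : S -> S -> Prop) (distS : S -> S -> R) (sol : D -> S -> Prop) : Prop :=
  [/\ forall d, exists s, sol d s,
      forall d s s', sol d s -> sol d s' -> eqS s s' &
      forall d s, sol d s -> forall e : R, 0 < e ->
        exists2 delta : R, 0 < delta &
          forall d' s', sol d' s' -> distD d d' < delta -> distS s s' < e].

(* Main.v *)
Require Import Defs.
From HB Require Import structures.
From mathcomp Require Import all_boot all_order all_algebra.
From mathcomp Require Import all_classical all_reals all_analysis.
From mathcomp Require Import measurable_realfun ring lra.
Set Implicit Arguments.
Unset Strict Implicit.
Unset Printing Implicit Defensive.
Import Order.TTheory GRing.Theory Num.Theory.
Import numFieldNormedType.Exports.
Local Open Scope classical_set_scope.
Local Open Scope ring_scope.

(** By [H2] regularity, [-lap] is a bijection, up to almost everywhere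
    equality, from the [H^2] functions with zero trace onto [L^2(Omega)], and
    the restriction to [Gamma] of such a function is bounded in [L^2(Gamma)] by
    its Laplacian in [L^2(Omega)].  The three problems therefore only involve two
    linear maps on V, the restriction [r] to [Gamma] and [q = - lap], and they are
    solved in that generality.

    Solvability.  The second equation of (b) gives
      [f = (beta^2 fp + gamma^2 q u) / (beta^2 + gamma^2)],
    and what remains is: for all [v],
      [(r u, r v) + k (q u, q v) = (ud, r v) + k (fp, q v)],
    with [k = gamma^2 beta^2 / (beta^2 + gamma^2)].  Writing [u = S x], where [S]
    is the solution operator of the Dirichlet problem, the left-hand side is an
    inner product on [L^2(Omega)] equivalent to the usual one, so that [u] is
    given by the Riesz representation theorem ([riesz], [mixed_var_exists]).
    Elements of [L^2] are functions, not classes, hence the inner products are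
    only positive semidefinite; [riesz] is proved for these by minimizing
    [B x x - 2 l x], and completeness of [L^2] is [riesz_fischer].

    Equivalence.  The cost of (a) is a quadratic polynomial along lines, whose
    derivative is the residual of (b) and whose leading coefficient is the
    nonnegative energy
      [|r w|^2 + gamma^2 |q w - h|^2 + beta^2 |h|^2]
    ([mixed_costE], [mixed_minP]).  The multiplier of (c) is
    [gamma^2 (- lap u - f)] ([mixed_varP]).

    Uniqueness and continuity.  Testing the difference of two problems of form (b)
    with the difference of their solutions bounds the energy of the latter by
    [|ud - ud'|^2 + beta^2 |fp - fp'|^2] ([mixed_stability]), and the energy
    controls the distances of the solution spaces.  The solution thus depends on
    the data in a Lipschitz way, which includes uniqueness.

    All this requires linear combinations of elements of V to be in V
    ([H20_linear]); for this, test functions and their derivatives have to be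
    square integrable, which holds since they are continuous with compact support
    and bounded sets have finite Lebesgue measure. *)

(** * Semidefinite inner products and Riesz representation *)

Section semi_inner.
Context (R : realType) (X : lmodType R).

(** A symmetric bilinear form with [B x x >= 0].  Definiteness is not asked for:
    the integral of [f * f] vanishes as soon as [f] vanishes almost everywhere. *)
Definition semi_inner (B : X -> X -> R) :=
  [/\ forall a x y z, B (a *: x + y) z = a * B x z + B y z,
      forall x y, B x y = B y x & forall x, 0 <= B x x].

(** Convergence of [x_] to [x] for the seminorm of [B]; [B (x_ n - x) (x_ n - x)]
    is the square of the seminorm of [x_ n - x]. *)
Definition seq_cvg (B : X -> X -> R) (x_ : nat -> X) (x : X) :=
  forall e, 0 < e -> exists N, forall n, (N <= n)%N ->
    B (x_ n - x) (x_ n - x) < e.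

(** Cauchy sequences for the seminorm of [B]. *)
Definition seq_cauchy (B : X -> X -> R) (x_ : nat -> X) :=
  forall e, 0 < e -> exists N, forall m n, (N <= m)%N -> (N <= n)%N ->
    B (x_ m - x_ n) (x_ m - x_ n) < e.

Context (B : X -> X -> R) (innerB : semi_inner B).

Lemma semi_innerDl x y z : B (x + y) z = B x z + B y z.
Proof. by have [linB _ _] := innerB; rewrite -{1}[x]scale1r linB mul1r. Qed.

Lemma semi_inner0l z : B 0 z = 0.
Proof. by apply: (addrI (B 0 z)); rewrite -semi_innerDl !addr0. Qed.

Lemma semi_innerZl a x z : B (a *: x) z = a * B x z.
Proof.
by have [linB _ _] := innerB; rewrite -[a *: x]addr0 linB semi_inner0l addr0.
Qed.

Lemma semi_innerC x y : B x y = B y x. Proof. by have [_ ->] := innerB. Qed.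

Lemma semi_innerDr x y z : B z (x + y) = B z x + B z y.
Proof. by rewrite semi_innerC semi_innerDl !(semi_innerC z). Qed.

Lemma semi_innerZr a x z : B z (a *: x) = a * B z x.
Proof. by rewrite semi_innerC semi_innerZl !(semi_innerC z). Qed.

Lemma semi_inner_ge0 x : 0 <= B x x. Proof. by have [_ _ ->] := innerB. Qed.

Lemma semi_innerNl x z : B (- x) z = - B x z.
Proof. by rewrite -scaleN1r semi_innerZl mulN1r. Qed.

Lemma semi_innerNr x z : B z (- x) = - B z x.
Proof. by rewrite semi_innerC semi_innerNl semi_innerC. Qed.

Definition semi_innerE := (semi_innerNl, semi_innerNr, semi_innerDl,
  semi_innerDr, semi_innerZl, semi_innerZr).

Lemma semi_inner_young x y : 2 * B x y <= B x x + B y y.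
Proof.
by have := semi_inner_ge0 (x - y); rewrite !semi_innerE (semi_innerC y x); lra.
Qed.

(** The polynomial [2 r t + b t^2] has a minimum at [t = 0], where its derivative
    is [2 r]. *)
Lemma quadratic_ge0_eq0 (b r : R) : (forall t, 0 <= 2 * t * r + t ^+ 2 * b) -> r = 0.
Proof.
move=> h.
(* any positive number above b / 2 would do as denominator *)
have h1 := h (- r / (`|b| + 1)).
have b0 : 0 < `|b| + 1 by rewrite ltr_wpDl.
have bb : b < `|b| + 1 by rewrite (le_lt_trans (ler_norm _))// ltrDl.
apply/eqP; apply: contraTT h1 => r0; rewrite -ltNge.
have -> : 2 * (- r / (`|b| + 1)) * r + (- r / (`|b| + 1)) ^+ 2 * b =
  (r / (`|b| + 1)) ^+ 2 * (b - 2 * (`|b| + 1)) by field; rewrite gt_eqF.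
rewrite pmulr_rlt0; last by rewrite exprn_even_gt0//= mulf_neq0// invr_neq0// gt_eqF.
by lra.
Qed.

Lemma cauchy_schwarz x y : B x y ^+ 2 <= B x x * B y y.
Proof.
(* the nonnegative polynomial B (x + t y) (x + t y) is evaluated at its minimum
   - B x y / B y y, or far away when it is affine *)
have h t : 0 <= B x x + 2 * t * B x y + t ^+ 2 * B y y.
  have := semi_inner_ge0 (x + t *: y); rewrite !semi_innerE (semi_innerC y x).
  by congr (0 <= _); ring.
have [y0|y0] := eqVneq (B y y) 0.
  suff -> : B x y = 0 by rewrite y0 expr0n mulr0.
  apply/eqP/negPn/negP => xy0.
  have := h (- (B x x + 1) / (2 * B x y)); rewrite y0 mulr0 addr0 leNgt => /negP; apply.
  have -> : B x x + 2 * (- (B x x + 1) / (2 * B x y)) * B x y = -1.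
    by field.
  by rewrite ltrN10.
have {}y0 : 0 < B y y by rewrite lt_neqAle eq_sym y0 semi_inner_ge0.
have := h (- B x y / B y y).
have -> : B x x + 2 * (- B x y / B y y) * B x y + (- B x y / B y y) ^+ 2 * B y y =
  (B x x * B y y - B x y ^+ 2) / B y y by field; rewrite gt_eqF.
by rewrite pmulr_lge0 ?invr_gt0// subr_ge0.
Qed.

Lemma semi_inner_null x y : B x x = 0 -> B x y = 0.
Proof.
move=> x0; have := cauchy_schwarz x y; rewrite x0 mul0r => h.
by apply/eqP; rewrite -sqrf_eq0 eq_le h sqr_ge0.
Qed.

(** A bounded linear form [l] on a complete semi-inner product space is
    represented by a vector: the limit of a minimizing sequence of
    [J x = B x x - 2 l x], which is a Cauchy sequence by the parallelogram
    identity. *)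
Lemma riesz (l : X -> R) :
    (forall x_, seq_cauchy B x_ -> exists x, seq_cvg B x_ x) ->
    (forall a x y, l (a *: x + y) = a * l x + l y) ->
    (exists C, forall x, l x ^+ 2 <= C * B x x) ->
  exists x, forall y, B x y = l y.
Proof.
move=> complB linl [C0 l_bound0].
pose C := `|C0|.
have C_ge0 : 0 <= C by rewrite normr_ge0.
have l_bound x : l x ^+ 2 <= C * B x x.
  by apply: le_trans (l_bound0 x) _; rewrite ler_wpM2r ?semi_inner_ge0// ler_norm.
have lD x y : l (x + y) = l x + l y by rewrite -{1}[x]scale1r linl mul1r.
have lZ a x : l (a *: x) = a * l x.
  rewrite -[a *: x]addr0 linl; suff -> : l 0 = 0 by rewrite addr0.
  by apply: (addrI (l 0)); rewrite -lD !addr0.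
pose J x := B x x - 2 * l x.
(* l x is at most sqrt (C b) with b = B x x, and 2 sqrt (C b) <= b + C *)
have J_bound x : - C <= J x.
  rewrite /J -subr_ge0 opprK.
  have bx := semi_inner_ge0 x; have := l_bound x.
  set b := B x x in bx *; set k := l x => kb.
  have : 2 * k <= b + C; last lra.
  rewrite (le_trans (ler_norm _))// -ler_sqr ?nnegrE ?addr_ge0// -normrX ger0_norm ?sqr_ge0//.
  have := sqr_ge0 (b - C); nra.
pose m := inf (range J).
have J_inf : has_inf (range J).
  by split; [exists (J 0), 0 | exists (- C) => _ [x _ <-]].
have m_le x : m <= J x by apply: ge_inf; [exact: J_inf.2|exists x].
have /choice[x_ x_P] n : exists x, J x < m + n.+1%:R^-1.
  have [|_ [x _ <-] ?] := @inf_adherent _ (range J) n.+1%:R^-1 _ J_inf.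
    by rewrite invr_gt0.
  by exists x.
have small e : 0 < e -> exists N, forall n, (N <= n)%N -> n.+1%:R^-1 < e :> R.
  move=> e0; have := archi_boundP (ltW (etrans (invr_gt0 e) e0)).
  set N := Num.bound _ => hN; exists N => n Nn.
  rewrite -[ltRHS]invrK ltf_pV2 ?posrE ?invr_gt0// (lt_le_trans hN)// ler_nat.
  exact: leqW.
have [|x x_x] := complB x_.
  (* B (x - y) (x - y) = 2 J x + 2 J y - 4 J ((x + y) / 2) *)
  move=> e e0; have [|N NP] := small (e / 4); first by rewrite divr_gt0.
  exists N => i j Ni Nj.
  have := x_P i; have := x_P j; have := NP _ Ni; have := NP _ Nj.
  have := m_le (2^-1 *: (x_ i + x_ j)).
  rewrite /J lZ lD !semi_innerE (semi_innerC (x_ j) (x_ i)).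
  move: (i.+1%:R^-1) (j.+1%:R^-1) => di dj.
  lra.
exists x => y; apply/eqP; rewrite -subr_eq0; apply/eqP.
(* J (x_ n + t y) >= m shows that 2 t (B (x_ n) y - l y) + t^2 b is at least
   - 1 / n.+1; the limit of this in n is the hypothesis of quadratic_ge0_eq0 *)
set b := B y y; apply: (@quadratic_ge0_eq0 b) => t.
have b0 : 0 <= b := semi_inner_ge0 y.
apply/ler_addgt0Pl => d d0; rewrite -lerBlDl sub0r.
have tb0 : 0 < 16 * (t ^+ 2 * b + 1) by rewrite mulr_gt0// ltr_wpDl// mulr_ge0// sqr_ge0.
have [|N1 N1P] := x_x (d ^+ 2 / (16 * (t ^+ 2 * b + 1))).
  by rewrite divr_gt0// exprn_gt0.
have [|N2 N2P] := small (d / 2); first by rewrite divr_gt0.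
pose n := maxn N1 N2.
have := N2P n (leq_maxr _ _); have := N1P n (leq_maxl _ _); have := x_P n.
have := m_le (x_ n + t *: y); rewrite /J lD lZ.
have := cauchy_schwarz (x_ n - x) y.
rewrite semi_innerDl semi_innerNl.
set D := B (x_ n - x) _; rewrite !semi_innerE (semi_innerC y) -/b => cs m1 m2 Dd nd.
have Dtb : D * (t ^+ 2 * b + 1) * 16 <= d ^+ 2.
  by move: Dd; rewrite ltr_pdivlMr// => /ltW; congr (_ <= _); ring.
have : 2 * t * (B (x_ n) y - B x y) <= d / 2.
  rewrite (le_trans (ler_norm _))// -ler_sqr ?nnegrE ?divr_ge0// 1?ltW//.
  rewrite -normrX ger0_norm ?sqr_ge0//.
  have D0 : 0 <= D by rewrite /D semi_inner_ge0.
  set z := B (x_ n) y - B x y in cs *.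
  have t2 := sqr_ge0 t.
  have : t ^+ 2 * z ^+ 2 <= t ^+ 2 * (D * b) by rewrite ler_wpM2l.
  by nra.
move: m1 m2 nd; move: (n.+1%:R^-1) => dn.
lra.
Qed.
End semi_inner.

(** * The space of square-integrable functions *)

Section L2.
Context d (T : measurableType d) (R : realType) (mu : {measure set T -> \bar R}).
Implicit Types f g h : T -> R.

Local Notation inner f g := (\int[mu]_x (f x * g x)).
Local Notation L2 := (LfunType mu (lee1n 2)).

Lemma Lfun_measurable (p : \bar R) f : f \in Lfun mu p -> measurable_fun setT f.
Proof. by rewrite inE => /andP[]; rewrite inE. Qed.

Lemma Lfun2_integrableM f g : f \in Lfun mu 2 -> g \in Lfun mu 2 ->
  mu.-integrable setT (EFin \o (fun x => f x * g x)).
Proof. by move=> f2 g2; apply/Lfun1_integrable/Lfun2_mul_Lfun1. Qed.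

Lemma Lfun2P f : measurable_fun setT f ->
  (\int[mu]_x (f x * f x)%:E < +oo)%E -> f \in Lfun mu 2.
Proof.
move=> mf foo; rewrite inE; apply/andP; split; rewrite inE//=.
rewrite /finite_norm unlock poweR_lty//.
rewrite [ltLHS](_ : _ = \int[mu]_x (f x * f x)%:E)%E//.
by apply: eq_integral => x _; rewrite /= -[2]/(2%:R) powR_mulrn// -normrX ger0_norm ?sqr_ge0.
Qed.

Lemma Lfun2_linear a b f g : f \in Lfun mu 2 -> g \in Lfun mu 2 ->
  (fun x => a * f x + b * g x) \in Lfun mu 2.
Proof.
move=> f2 g2.
exact: (LfunP (a *: Lfun_Sub (lee1n 2) f2 + b *: Lfun_Sub (lee1n 2) g2)).
Qed.

(** The integral is finite, so that its real-valued version loses nothing. *)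
Lemma Lfun2_innerE f : f \in Lfun mu 2 ->
  (inner f f)%:E = (\int[mu]_x (f x * f x)%:E)%E.
Proof.
move=> f2; rewrite /Rintegral fineK//.
by apply: integrable_fin_num => //; exact: Lfun2_integrableM.
Qed.

Lemma inner_linear a b f g h : f \in Lfun mu 2 -> g \in Lfun mu 2 ->
  h \in Lfun mu 2 ->
  \int[mu]_x ((a * f x + b * g x) * h x) = a * inner f h + b * inner g h.
Proof.
move=> f2 g2 h2.
have If := Lfun2_integrableM f2 h2; have Ig := Lfun2_integrableM g2 h2.
rewrite -!RintegralZl// -RintegralD//; last 2 first.
- exact: (integrableZl measurableT a If).
- exact: (integrableZl measurableT b Ig).
by apply: eq_Rintegral => x _; ring.
Qed.

Lemma innerC f g : inner f g = inner g f.
Proof. by apply: eq_Rintegral => x _; rewrite mulrC. Qed.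

Lemma inner_ge0 f : 0 <= inner f f.
Proof. by apply: Rintegral_ge0 => x _; rewrite -expr2 sqr_ge0. Qed.

Lemma inner_sqr a b f g : f \in Lfun mu 2 -> g \in Lfun mu 2 ->
  \int[mu]_x ((a * f x + b * g x) * (a * f x + b * g x)) =
  a ^+ 2 * inner f f + 2 * a * b * inner f g + b ^+ 2 * inner g g.
Proof.
move=> f2 g2; have h2 := Lfun2_linear a b f2 g2.
rewrite inner_linear// !(innerC _ (fun x => a * f x + b * g x)) !inner_linear//.
rewrite (innerC g f); ring.
Qed.

Lemma inner_sqr_le a b f g : f \in Lfun mu 2 -> g \in Lfun mu 2 ->
  \int[mu]_x ((a * f x + b * g x) * (a * f x + b * g x)) <=
  2 * a ^+ 2 * inner f f + 2 * b ^+ 2 * inner g g.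
Proof.
move=> f2 g2; have := inner_ge0 (fun x => a * f x + - b * g x).
by rewrite !inner_sqr//; lra.
Qed.

Lemma inner_ae f g h : measurable_fun setT f -> measurable_fun setT g ->
  measurable_fun setT h -> f = g %[ae mu] -> inner f h = inner g h.
Proof.
move=> mf mg mh fg; congr fine; apply: ae_eq_integral => //.
- by apply/measurable_EFinP; exact: measurable_funM.
- by apply/measurable_EFinP; exact: measurable_funM.
- by apply: filterS fg => x /= fg _; rewrite fg.
Qed.

Lemma inner_eq0 f : f \in Lfun mu 2 -> inner f f = 0 -> f = 0 %[ae mu].
Proof.
move=> f2 f0; have mf := Lfun_measurable f2.
have := Lfun2_innerE f2; rewrite f0 => /esym f0'.
have /(ae_eq_integral_abs mu measurableT)[+ _] :
    measurable_fun setT (fun x => (f x * f x)%:E).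
  by apply/measurable_EFinP; exact: measurable_funM.
rewrite (_ : (\int[mu]_x `|(f x * f x)%:E|)%E = 0%E); last first.
  apply: etrans f0'; apply: eq_integral => x _.
  by rewrite gee0_abs// lee_fin -expr2 sqr_ge0.
move=> /(_ erefl); apply: filterS => x /(_ I) [/eqP].
by rewrite mulf_eq0 orbb => /eqP.
Qed.

(** [inner] is the inner product of [L^2(mu)]. *)
Lemma semi_inner_L2 : semi_inner (fun f g : L2 => inner f g).
Proof.
split=> [a f g h|f g|f]; [|exact: innerC|exact: inner_ge0].
rewrite -[inner g h]mul1r -inner_linear; try exact: LfunP.
by apply: eq_Rintegral => x _; congr (_ * _); rewrite mul1r.
Qed.

Lemma limn_einf_le (u : (\bar R)^nat) c : (forall k, u k <= c)%E ->
  (limn_einf u <= c)%E.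
Proof.
move=> uc; rewrite limn_einf_lim; apply: lime_le; first exact: is_cvg_einfs.
apply: nearW => k; apply: ge_ereal_inf; exists (u k) => //.
by exists k => /=.
Qed.

(** A summable sequence of positive numbers. *)
Let c (k : nat) : R := 1 / (2 ^ k.+1)%:R.

Let c_gt0 k : 0 < c k.
Proof. by rewrite /c div1r invr_gt0 ltr0n expn_gt0. Qed.

Let c_sum : (\sum_(0 <= k <oo) (c k)%:E <= 1)%E.
Proof. exact: epsilon_trick0. Qed.

(** If [|h_ k|_2 <= c k] then the series of the [h_ k] converges almost everywhere,
    since [|h_ k| <= h_ k ^ 2 / c k + c k] and the series of the [h_ k ^ 2 / c k]
    has a finite integral.  No finiteness of the measure is needed. *)
Lemma ae_cvg_series (h_ : nat -> T -> R) :
    (forall k, measurable_fun setT (h_ k)) ->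
    (forall k, \int[mu]_x (h_ k x * h_ k x)%:E <= (c k * c k)%:E)%E ->
  \forall x \ae mu, cvgn (series (h_ ^~ x)).
Proof.
move=> mh hc.
pose g_ k x := ((c k)^-1 * (h_ k x * h_ k x))%:E.
have g_ge0 k x : (0 <= g_ k x)%E.
  by rewrite lee_fin mulr_ge0 ?invr_ge0 ?(ltW (c_gt0 k))// -expr2 sqr_ge0.
have mhh k : measurable_fun setT (fun x => h_ k x * h_ k x) by exact: measurable_funM.
have mg k : measurable_fun setT (g_ k).
  by apply/measurable_EFinP; exact: measurable_funM.
have intg k : (\int[mu]_x g_ k x <= (c k)%:E)%E.
  under eq_integral do rewrite /g_ EFinM.
  rewrite ge0_integralZl//; last 3 first.
  - exact/measurable_EFinP.
  - by move=> x _; rewrite lee_fin -expr2 sqr_ge0.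
  - by rewrite lee_fin invr_ge0 ltW.
  apply: le_trans (lee_wpmul2l _ (hc k)) _; first by rewrite lee_fin invr_ge0 ltW.
  by rewrite -EFinM mulKf// gt_eqF.
have mG : measurable_fun setT (fun x => \sum_(0 <= k <oo) g_ k x)%E.
  by apply: ge0_emeasurable_sum.
have G_ge0 x : (0 <= \sum_(0 <= k <oo) g_ k x)%E by exact: nneseries_ge0.
have : mu.-integrable setT (fun x => \sum_(0 <= k <oo) g_ k x)%E.
  apply/integrableP; split => //.
  under eq_integral do rewrite gee0_abs//.
  rewrite integral_nneseries//.
  apply: (@le_lt_trans _ _ 1%E); last exact: ltry.
  apply: le_trans c_sum; apply: lee_nneseries => // k _ _.
  exact: integral_ge0.
move=> /(integrable_ae measurableT); apply: filterS => x /(_ I) Gx.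
apply: normed_cvg.
have cvgg : cvgn (series (fun k => (c k)^-1 * (h_ k x * h_ k x))).
  apply: nnseries_is_cvg => [k|]; first by rewrite -lee_fin; exact: g_ge0.
  by rewrite ltey_eq Gx.
have cvgc : cvgn (series c).
  apply: nnseries_is_cvg => [k|]; first exact: ltW.
  by rewrite (le_lt_trans c_sum)// ltry.
have hh_ge0 k : 0 <= (c k)^-1 * (h_ k x * h_ k x) by rewrite -lee_fin; exact: g_ge0.
apply: (@series_le_cvg _ _ (fun k => (c k)^-1 * (h_ k x * h_ k x) + c k)) => [k|k|k|].
- exact: normr_ge0.
- by rewrite addr_ge0// ltW.
- (* from 2 |h| c <= h ^ 2 + c ^ 2 *)
  rewrite /=; have ck := c_gt0 k.
  rewrite -(ler_pM2r ck) mulrDl mulrAC mulVf ?gt_eqF// mul1r -expr2 -real_normK ?num_real//.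
  have := normr_ge0 (h_ k x); move: `|_| => a a0.
  by have := sqr_ge0 (a - c k); nra.
- exact: is_cvg_seriesD cvgg cvgc.
Qed.

(** [L^2(mu)] is complete: a Cauchy sequence has a subsequence that converges almost
    everywhere, and its pointwise limit is a limit in [L^2] by Fatou's lemma. *)
Lemma riesz_fischer (f_ : nat -> L2) :
  seq_cauchy (fun f g : L2 => inner f g) f_ ->
  exists f : L2, seq_cvg (fun f g : L2 => inner f g) f_ f.
Proof.
move=> cf.
have /choice[N NP] k := cf (c k * c k) (mulr_gt0 (c_gt0 k) (c_gt0 k)).
pose p k := (\sum_(i < k.+1) (N i).+1)%N.
have Np k : (N k <= p k)%N.
  by rewrite /p big_ord_recr/= (leq_trans (leqnSn _))// leq_addl.
have kp k : (k <= p k)%N.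
  rewrite ltnW// /p -[X in (X <= _)%N]card_ord -sum1_card leq_sum//.
have pS k : (p k <= p k.+1)%N by rewrite {2}/p big_ord_recr/= leq_addr.
have normE (i j : nat) : ((inner (f_ i - f_ j : L2) (f_ i - f_ j : L2))%:E =
    \int[mu]_x ((f_ i x - f_ j x) * (f_ i x - f_ j x))%:E)%E.
  by rewrite Lfun2_innerE//; exact: LfunP.
have mB (i j : nat) : measurable_fun setT (fun x => f_ i x - f_ j x).
  exact: measurable_funB.
have := @ae_cvg_series (fun k x => f_ (p k.+1) x - f_ (p k) x) (fun k => mB _ _).
have H k : (\int[mu]_x
     ((f_ (p k.+1) x - f_ (p k) x) * (f_ (p k.+1) x - f_ (p k) x))%:E <=
     (c k * c k)%:E)%E.
  rewrite -normE lee_fin ltW// NP//.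
  by rewrite (leq_trans (Np k)).
move=> /(_ H) {H} cvg_ae.
(* the superior limit is measurable everywhere, not only almost everywhere *)
pose f x := fine (limn_esup (fun k => (f_ (p k) x)%:E)).
have mf : measurable_fun setT f.
  apply: measurableT_comp => //.
  apply: measurable_realfun.measurable_fun_limn_esup => k.
  exact/measurable_EFinP.
have {}cvg_ae : \forall x \ae mu, (fun k => f_ (p k) x) @ \oo --> f x.
  apply: filterS cvg_ae => x cvgx.
  have {cvgx} : cvgn (fun k => f_ (p k) x).
    rewrite (_ : (fun k => _) = (fun k => f_ (p 0%N) x +
      series (fun k => f_ (p k.+1) x - f_ (p k) x) k)); first exact: is_cvgD (is_cvg_cst _) cvgx.
    by apply/funext => k; exact: (@eq_sum_telescope _ (fun k => f_ (p k) x)).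
  move=> cvgx; rewrite /f.
  have -> : limn_esup (fun k => (f_ (p k) x)%:E) = (limn (fun k => f_ (p k) x))%:E.
    apply: (cvg_limn_einf_sup _).2.
    by apply: cvg_EFin cvgx; exact: nearW.
  exact: cvgx.
(* |f_ i - f|_2^2 <= e if |f_ i - f_ (p k)|_2^2 <= e for large k, by Fatou *)
have int_le i e K :
    (forall k, (K <= k)%N -> inner (f_ i - f_ (p k) : L2) (f_ i - f_ (p k) : L2) <= e) ->
  (\int[mu]_x ((f_ i x - f x) * (f_ i x - f x))%:E <= e%:E)%E.
  move=> iK.
  pose u k x := ((f_ i x - f_ (p (k + K)%N) x) * (f_ i x - f_ (p (k + K)%N) x))%:E.
  have mu_ k : measurable_fun setT (u k).
    by apply/measurable_EFinP; exact: measurable_funM.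
  have u_ge0 k x : setT x -> (0 <= u k x)%E by rewrite lee_fin -expr2 sqr_ge0.
  rewrite (@ae_eq_integral _ _ _ _ _ (fun x => limn_einf (u ^~ x)))//; last 3 first.
  - by apply/measurable_EFinP; apply: measurable_funM; exact: measurable_funB.
  - rewrite (_ : (fun x => _) = (fun x => - limn_esup (fun k => - u k x))%E).
      apply: measurableT_comp => //.
      apply: measurable_fun_limn_esup => k; exact: measurableT_comp.
    by apply/funext => x; rewrite -limn_einfN; congr limn_einf;
      apply/funext => k; exact: (esym (oppeK _)).
  - apply: filterS cvg_ae => x cvgx _; symmetry.
    apply: (cvg_limn_einf_sup _).1; apply: cvg_EFin; first exact: nearW.
    have h : (fun k => f_ i x - f_ (p (k + K)%N) x) @ \oo --> f_ i x - f x.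
      apply: cvgB; first exact: cvg_cst.
      by rewrite (cvg_shiftn K (fun k => f_ (p k) x)).
    exact: (cvgM h h).
  apply: le_trans (fatou mu measurableT mu_ u_ge0) _.
  apply: limn_einf_le => k.
  by rewrite /u -normE lee_fin iK// leq_addl.
have f2 : f \in Lfun mu 2.
  have [N0 N0P] := cf 1 ltr01.
  have g2 : f_ N0 \- f \in Lfun mu 2.
    apply: Lfun2P; first exact: measurable_funB.
    apply: (@le_lt_trans _ _ 1%:E); last exact: ltry.
    apply: (int_le _ _ N0) => k Nk; apply/ltW/N0P => //.
    exact: leq_trans Nk (kp k).
  have -> : f = (fun x => 1 * f_ N0 x + -1 * (f_ N0 \- f) x).
    by apply/funext => x /=; ring.
  by apply: Lfun2_linear => //; exact: (LfunP (f_ N0)).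
exists (Lfun_Sub _ f2) => e e0.
have e20 : 0 < e / 2 by rewrite divr_gt0.
have [N0 N0P] := cf _ e20; exists N0 => n N0n.
apply: (@le_lt_trans _ _ (e / 2)); last by rewrite gtr_pMr// invf_lt1// ltr1n.
rewrite -lee_fin Lfun2_innerE; last exact: LfunP.
apply: (int_le _ _ N0) => k Nk; apply/ltW/N0P => //.
exact: leq_trans Nk (kp k).
Qed.
End L2.

(** * Test functions and linear combinations in H^2 with zero trace *)

Section test_functions.
Context (R : realType) (n : nat).
Implicit Types (D : domain R n) (phi psi : 'rV[R]_n -> R).

(** A bounded set is contained in a ball for the maximum norm, which is a box. *)
Lemma lebesgue_rV_lty (A : set 'rV[R]_n) : measurable A -> bounded_set A ->
  (lebesgue_rV R n A < +oo)%E.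
Proof.
move=> mA [M [_ AM]].
pose r := `|M| + 1.
have AB : A `<=` ball (0 : 'rV[R]_n) (r + 1).
  move=> x Ax; rewrite -ball_normE /= sub0r normrN.
  apply: (@le_lt_trans _ _ r); last by rewrite ltrDl.
  by apply: AM => //; rewrite /r (le_lt_trans (ler_norm _))// ltrDl.
have r0 : 0 < r + 1 by rewrite /r -addrA ltr_wpDl// addr_gt0.
apply: (@le_lt_trans _ _ (lebesgue_rV R n (ball (0 : 'rV[R]_n) (r + 1)))).
  apply: le_measure AB; rewrite inE//.
  by apply: rV_open_measurable; exact: ball_open.
rewrite (_ : ball _ _ = [set x : 'rV[R]_n | forall i,
    (const_mx (- (r + 1)) : 'rV[R]_n) 0 i < x 0 i < (const_mx (r + 1) : 'rV[R]_n) 0 i]).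
  rewrite lebesgue_rV_box ?ltry// => i; rewrite !mxE.
  by rewrite (@le_trans _ _ 0)// ?oppr_le0 ltW.
apply/seteqP; split=> [x [_ xr] i|x xr].
  by have := xr 0 i; rewrite /ball/= !mxE sub0r normrN ltr_norml.
split=> // i j; have := xr j; rewrite (ord1 i) !mxE /ball/= sub0r normrN.
by rewrite ltr_norml.
Qed.

Lemma continuous_rV_measurable (f : 'rV[R]_n -> R) : continuous f ->
  measurable_fun setT f.
Proof.
move=> cf; apply: (measurability _ (RGenOpens.measurableE R)) => _ [U [a [b ->]] <-].
rewrite setTI; apply: rV_open_measurable; apply: open_comp => // x _; exact: cf.
Qed.

(** A continuous function vanishing outside a compact set is bounded by a multiple
    of the indicator function of that set, which has finite measure. *)
Lemma continuous_compact_Lfun D (f : 'rV[R]_n -> R) (K : set 'rV[R]_n) :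
    continuous f -> compact K -> (forall x, ~ K x -> f x = 0) ->
  f \in Lfun (lebesgue_on D) 2.
Proof.
move=> cf cK f0.
have mf := continuous_rV_measurable cf.
have mK : measurable K.
  rewrite -[K]setCK; apply: measurableC; apply: rV_open_measurable.
  by apply: closed_openC; apply: compact_closed => //; exact: norm_hausdorff.
have [M [_ fM]] : bounded_set (f @` K).
  apply: compact_bounded; apply: continuous_compact => //.
  exact: continuous_subspaceT.
have {}fM x : K x -> `|f x| <= `|M| + 1.
  by move=> Kx; apply: fM; [rewrite (le_lt_trans (ler_norm _))// ltrDl|exists x].
apply: Lfun2P => //.
apply: (@le_lt_trans _ _ (\int[lebesgue_on D]_(x in K) ((`|M| + 1) ^+ 2)%:E)%E).
  rewrite [leRHS]integral_mkcond; apply: ge0_le_integral => //.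
  - by move=> x _; rewrite lee_fin -expr2 sqr_ge0.
  - by apply/measurable_EFinP; exact: measurable_funM.
  - by apply: (measurable_restrictT _ mK).1; exact: measurable_cst.
  - move=> x _; rewrite /restrict; case: ifPn => [|/negP].
      rewrite inE => Kx; rewrite lee_fin -expr2 -real_normK ?num_real//.
      by rewrite ler_sqr ?nnegrE ?addr_ge0//; exact: fM.
    by rewrite inE => /f0 ->; rewrite mulr0.
rewrite integral_cst// lte_mul_pinfty ?lee_fin ?sqr_ge0//.
apply: (@le_lt_trans _ _ (lebesgue_rV R n K)).
  apply: le_measure; rewrite ?inE//.
  by apply: measurableI => //; exact: rV_open_measurable (@domain_open _ _ D).
by apply: lebesgue_rV_lty => //; exact: compact_bounded.
Qed.

(** The closed support of a function. *)
Definition support (phi : 'rV[R]_n -> R) := closure [set x | phi x != 0].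

Lemma support0 phi x : ~ support phi x -> phi x = 0.
Proof.
by move=> h; apply/eqP/negPn/negP => px; apply: h; exact: subset_closure.
Qed.

Lemma partial_support0 i phi x : ~ support phi x -> partial i phi x = 0.
Proof.
move=> h.
have : \forall y \near x, phi y = (cst 0 : 'rV[R]_n -> R) y.
  have : nbhs x (~` support phi).
    by apply: open_nbhs_nbhs; split => //; apply: closed_openC; exact: closed_closure.
  by apply: filterS => y; exact: support0.
by move=> /near_eq_derive e; rewrite /partial e derive_cst.
Qed.

Lemma test_function_Lfun D phi : test_function D phi ->
  phi \in Lfun (lebesgue_on D) 2.
Proof.
move=> [sm cK _]; apply: continuous_compact_Lfun cK _; first exact: (sm [::]).1.
by move=> x; exact: support0.
Qed.

Lemma partial_Lfun D i phi : test_function D phi ->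
  partial i phi \in Lfun (lebesgue_on D) 2.
Proof.
move=> [sm cK _]; apply: continuous_compact_Lfun cK _; first exact: (sm [:: i]).1.
by move=> x; exact: partial_support0.
Qed.

Lemma partial_linear a b i phi psi x :
    derivable phi x (delta_mx 0 i) -> derivable psi x (delta_mx 0 i) ->
  partial i (fun x => a * phi x + b * psi x) x =
    a * partial i phi x + b * partial i psi x.
Proof.
move=> dphi dpsi; rewrite /partial.
rewrite (_ : (fun x => _) = a *: phi + b *: psi)//.
by rewrite deriveD ?deriveZ//; exact: derivableZ.
Qed.

Lemma smooth_linear a b phi psi : smooth phi -> smooth psi ->
  smooth (fun x => a * phi x + b * psi x).
Proof.
move=> sphi spsi.
have E s : foldr (@partial R n) (fun x => a * phi x + b * psi x) s =
    (fun x => a * foldr (@partial R n) phi s x + b * foldr (@partial R n) psi s x).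
  elim: s => [|i s IH]//=; apply/funext => x; rewrite IH partial_linear//.
    exact: (sphi s).2.
  exact: (spsi s).2.
move=> s; rewrite E; split=> [x|i x].
  exact: cvgD (cvgM (cvg_cst a) ((sphi s).1 x)) (cvgM (cvg_cst b) ((spsi s).1 x)).
apply: (@derivableD _ _ _ (a *: _) (b *: _)); apply: derivableZ.
  exact: (sphi s).2.
exact: (spsi s).2.
Qed.

Lemma test_function_linear D a b phi psi :
    test_function D phi -> test_function D psi ->
  test_function D (fun x => a * phi x + b * psi x).
Proof.
move=> [sphi cphi Dphi] [spsi cpsi Dpsi].
have sub : closure [set x | a * phi x + b * psi x != 0] `<=`
    support phi `|` support psi.
  rewrite /support -closureU; apply: closureS => x /= h.
  apply/orP; apply: contraNT h; rewrite negb_or !negbK => /andP[/eqP -> /eqP ->].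
  by rewrite !mulr0 addr0.
split; first exact: smooth_linear.
- apply: subclosed_compact sub; first exact: closed_closure.
  exact: compactU.
- by apply: subset_trans sub _ => x [/Dphi|/Dpsi].
Qed.

Lemma Lfun2B D (f g : 'rV[R]_n -> R) : f \in Lfun (lebesgue_on D) 2 ->
  g \in Lfun (lebesgue_on D) 2 -> f \- g \in Lfun (lebesgue_on D) 2.
Proof.
move=> f2 g2; rewrite (_ : f \- g = (fun x => 1 * f x + - 1 * g x)).
  exact: Lfun2_linear.
by apply/funext => x /=; ring.
Qed.

Lemma L2_normK D f : L2_norm D f ^+ 2 = L2_inner D f f.
Proof. by rewrite sqr_sqrtr//; exact: inner_ge0. Qed.

Lemma weighted_sum_lt (x y d e u v : R) : 0 < e -> d * (x + y) <= e / 4 ->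
  x * u <= x * d -> y * v <= y * d -> 2 * x * u + 2 * y * v < e.
Proof. by lra. Qed.

(** [H^2] functions with zero trace form a vector space, on which the Laplacian is
    linear.  The identities hold everywhere, because the derivatives of the
    combination are taken to be the combinations of the derivatives. *)
Lemma H20_linear D a b (u v : H20 D) : exists w : H20 D,
  (forall x, w x = a * u x + b * v x) /\
  (forall x, lap w x = a * lap u x + b * lap v x).
Proof.
have wp i (u1 u2 g1 g2 : L2 D) : weak_partial i u1 g1 -> weak_partial i u2 g2 ->
    weak_partial i (a *: u1 + b *: u2) (a *: g1 + b *: g2).
  move=> h1 h2 phi tphi.
  have dphi2 := partial_Lfun i tphi; have phi2 := test_function_Lfun tphi.
  rewrite /L2_inner.
  rewrite (inner_linear a b (LfunP u1) (LfunP u2) dphi2).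
  rewrite (inner_linear a b (LfunP g1) (LfunP g2) phi2).
  have := h1 _ tphi; have := h2 _ tphi; rewrite /L2_inner => -> ->; ring.
pose w := @MkH2 R n D (a *: H2_fun u + b *: H2_fun v)
  (fun i => a *: grad u i + b *: grad v i)
  (fun i j => a *: hess u i j + b *: hess v i j)
  (fun i => wp i _ _ _ _ (gradP u i) (gradP v i))
  (fun i j => wp j _ _ _ _ (hessP u i j) (hessP v i j)).
(* parallelogram inequality |a F + b G|^2 <= 2 a^2 |F|^2 + 2 b^2 |G|^2 *)
have sqr_le (f g phi psi : 'rV[R]_n -> R) :
    f \in Lfun (lebesgue_on D) 2 -> g \in Lfun (lebesgue_on D) 2 ->
    phi \in Lfun (lebesgue_on D) 2 -> psi \in Lfun (lebesgue_on D) 2 ->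
  L2_norm D (fun x => a * f x + b * g x - (a * phi x + b * psi x)) ^+ 2 <=
  2 * a ^+ 2 * L2_norm D (f \- phi) ^+ 2 + 2 * b ^+ 2 * L2_norm D (g \- psi) ^+ 2.
  move=> f2 g2 phi2 psi2.
  rewrite !L2_normK; apply: le_trans (inner_sqr_le a b (Lfun2B f2 phi2) (Lfun2B g2 psi2)).
  by rewrite le_eqVlt; apply/orP; left; apply/eqP; apply: eq_Rintegral => x _ /=; ring.
have tw : zero_trace w.
  (* approximating u and v up to e / (2 K) is enough since a^2 + b^2 <= K^2 *)
  move=> e e0; pose K := `|a| + `|b| + 1.
  have K0 : 0 < K by rewrite /K ltr_wpDl// addr_ge0.
  have d0 : 0 < e / (2 * K) by rewrite divr_gt0// mulr_gt0.
  have [phi tphi uphi] := H20_trace u d0; have [psi tpsi vpsi] := H20_trace v d0.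
  exists (fun x => a * phi x + b * psi x); first exact: test_function_linear.
  have lephi := test_function_Lfun tphi; have lepsi := test_function_Lfun tpsi.
  pose Nu := L2_norm D (u \- phi) ^+ 2 + \sum_i L2_norm D (grad u i \- partial i phi) ^+ 2.
  pose Nv := L2_norm D (v \- psi) ^+ 2 + \sum_i L2_norm D (grad v i \- partial i psi) ^+ 2.
  apply: (@le_lt_trans _ _ (2 * a ^+ 2 * Nu + 2 * b ^+ 2 * Nv)).
    rewrite /Nu /Nv 2!mulrDr addrACA !mulr_sumr -big_split/=.
    apply: lerD; first by apply: sqr_le => //; exact: LfunP.
    apply: ler_sum => i _.
    rewrite (_ : partial i _ = (fun x => a * partial i phi x + b * partial i psi x)).
      apply: sqr_le; [exact: LfunP|exact: LfunP|exact: partial_Lfun|exact: partial_Lfun].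
    case: tphi => sphi _ _; case: tpsi => spsi _ _.
    by apply/funext => x; rewrite partial_linear//;
      [exact: (sphi [::]).2|exact: (spsi [::]).2].
  have K2 : a ^+ 2 + b ^+ 2 <= K ^+ 2.
    rewrite -(real_normK (num_real a)) -(real_normK (num_real b)) /K.
    move: (normr_ge0 a) (normr_ge0 b); move: `|a| `|b| => x y x0 y0.
    have -> : (x + y + 1) ^+ 2 = x ^+ 2 + y ^+ 2 + (2 * (x * y) + 2 * x + 2 * y + 1) by ring.
    by rewrite lerDl !addr_ge0// ?mulr_ge0.
  have dK : (e / (2 * K)) ^+ 2 * K ^+ 2 = e ^+ 2 / 4 by field; rewrite gt_eqF.
  have e2 : 0 < e ^+ 2 by rewrite exprn_gt0.
  have a2 := sqr_ge0 a; have b2 := sqr_ge0 b.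
  have d2 := sqr_ge0 (e / (2 * K)).
  move: (ler_wpM2l a2 (ltW (uphi : Nu < _))) (ler_wpM2l b2 (ltW (vpsi : Nv < _))).
  move: (ler_wpM2l d2 K2); rewrite dK.
  exact: weighted_sum_lt.
exists (MkH20 tw); split => // x.
by rewrite /lap big_split/= -!scaler_sumr.
Qed.
End test_functions.

(** * The three problems in abstract form *)

Section mixed_problem.
(** [A] and [X] stand for the L^2 spaces of [Gamma] and [Omega] with inner products
    [a] and [o], [V] for the H^2 functions with zero trace, [r] for the restriction
    to [Gamma] and [q] for [- lap].  [V] is only a type: [lin] says that it has
    linear combinations. *)
Context (R : realType) (A X : lmodType R) (V : Type) (r : V -> A) (q : V -> X)
  (a : A -> A -> R) (o : X -> X -> R) (beta gamma : R).
Hypotheses (innerA : semi_inner a) (innerX : semi_inner o)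
  (beta_gt0 : 0 < beta) (gamma_gt0 : 0 < gamma).
Hypothesis lin : forall c e u v, exists w,
  r w = c *: r u + e *: r v /\ q w = c *: q u + e *: q v.

(** The cost functional of the minimization problem. *)
Definition mixed_cost (d : A * X) (v : V) (g : X) : R :=
  gamma ^+ 2 * o (q v - g) (q v - g) + a (r v - d.1) (r v - d.1) +
  beta ^+ 2 * o (g - d.2) (g - d.2).

(** [s] minimizes the cost. *)
Definition mixed_min (d : A * X) (s : V * X) : Prop :=
  forall v g, mixed_cost d s.1 s.2 <= mixed_cost d v g.

(** The variational problem. *)
Definition mixed_var (d : A * X) (s : V * X) : Prop :=
  (forall v, a (r s.1) (r v) + gamma ^+ 2 * o (q s.1 - s.2) (q v) = a d.1 (r v)) /\
  (forall g, gamma ^+ 2 * o (q s.1) (- g) + (beta ^+ 2 + gamma ^+ 2) * o s.2 g =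
     beta ^+ 2 * o d.2 g).

(** The penalized saddle-point problem; [s] is a triple (state, control,
    multiplier). *)
Definition mixed_lag (d : A * X) (s : V * X * X) : Prop :=
  [/\ forall v, a (r s.1.1) (r v) + o s.2 (q v) = a d.1 (r v),
      forall g, beta ^+ 2 * o s.1.2 g + o s.2 (- g) = beta ^+ 2 * o d.2 g &
      forall mu, o (q s.1.1 - s.1.2) mu - (gamma ^+ 2)^-1 * o s.2 mu = 0].

(** The quadratic form of the minimization problem, with [w] and [p] in the roles
    of [r v] and [q v]. *)
Definition mixed_energy (w : A) (p h : X) : R :=
  a w w + gamma ^+ 2 * o (p - h) (p - h) + beta ^+ 2 * o h h.

Let aE := semi_innerE innerA.
Let oE := semi_innerE innerX.
Let gamma2 : gamma ^+ 2 != 0. Proof. by rewrite expf_neq0// gt_eqF. Qed.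

Lemma mixed_energy_ge0 w p h : 0 <= mixed_energy w p h.
Proof.
have a_ge0 := semi_inner_ge0 innerA; have o_ge0 := semi_inner_ge0 innerX.
by rewrite !addr_ge0// mulr_ge0// sqr_ge0.
Qed.

(** Expansion of the cost on the line through [(u, f)] with direction [(v, g)]: the
    linear coefficient is twice the residual of the variational problem at [(u, f)]
    tested with [(v, g)]. *)
Lemma mixed_costE d u f t v g w :
  r w = r u + t *: r v -> q w = q u + t *: q v ->
  mixed_cost d w (f + t *: g) = mixed_cost d u f +
    2 * t * ((a (r u) (r v) + gamma ^+ 2 * o (q u - f) (q v) - a d.1 (r v)) +
       (gamma ^+ 2 * o (q u) (- g) + (beta ^+ 2 + gamma ^+ 2) * o f g -
         beta ^+ 2 * o d.2 g)) +
    t ^+ 2 * mixed_energy (r v) (q v) g.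
Proof.
move=> rw qw; rewrite /mixed_cost /mixed_energy rw qw !aE !oE.
rewrite (semi_innerC innerA (r v) (r u)) (semi_innerC innerA d.1 (r u)).
rewrite (semi_innerC innerA d.1 (r v)).
rewrite (semi_innerC innerX (q v) (q u)) (semi_innerC innerX f (q u)).
rewrite (semi_innerC innerX g (q u)) (semi_innerC innerX (q v) f).
rewrite (semi_innerC innerX g f) (semi_innerC innerX (q v) g).
rewrite (semi_innerC innerX d.2 f) (semi_innerC innerX d.2 g).
by ring.
Qed.

(** A point is a minimizer of a convex quadratic functional exactly when the
    derivative vanishes there. *)
Lemma mixed_minP d s : mixed_min d s <-> mixed_var d s.
Proof.
case: s => u f; split=> [min|[var1 var2] v g].
  have key v g : (a (r u) (r v) + gamma ^+ 2 * o (q u - f) (q v) - a d.1 (r v)) +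
       (gamma ^+ 2 * o (q u) (- g) + (beta ^+ 2 + gamma ^+ 2) * o f g -
         beta ^+ 2 * o d.2 g) = 0.
    apply: (@quadratic_ge0_eq0 _ (mixed_energy (r v) (q v) g)) => t.
    have [w [rw qw]] := lin 1 t u v; rewrite !scale1r in rw qw.
    by have := min w (f + t *: g); rewrite (mixed_costE _ _ _ rw qw)/=; lra.
  (* z has the role of the zero element of V *)
  have [z [rz qz]] := lin 0 0 u u; rewrite !scale0r addr0 in rz qz.
  split=> [v|g].
    have := key v 0; rewrite -[0 : X](@scale0r R X 0) !oE; lra.
  by have := key z g; rewrite rz qz -[0 : X](@scale0r R X 0) -[0 : A](@scale0r R A 0) !aE !oE; lra.
(* w has the role of v - u *)
have [w [rw qw]] := lin 1 (-1) v u.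
have rv : r v = r u + 1 *: r w.
  by rewrite rw !scale1r scaleN1r addrC subrK.
have qv : q v = q u + 1 *: q w.
  by rewrite qw !scale1r scaleN1r addrC subrK.
have -> : g = f + 1 *: (g - f) by rewrite scale1r addrC subrK.
rewrite (mixed_costE _ _ _ rv qv) /= var1 var2 !subrr addr0 mulr0 addr0.
by rewrite lerDl mulr_ge0 ?sqr_ge0// mixed_energy_ge0.
Qed.

Lemma mixed_lag_multiplier d u f l : mixed_lag d (u, f, l) ->
  forall mu, o l mu = gamma ^+ 2 * o (q u - f) mu.
Proof.
by move=> [_ _ h] mu; have /= := h mu => /subr0_eq ->; rewrite mulVKf.
Qed.

Lemma mixed_lag_var d u f l : mixed_lag d (u, f, l) -> mixed_var d (u, f).
Proof.
move=> lag; have lP := mixed_lag_multiplier lag; have [lag1 lag2 _] := lag.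
split=> [v|g] /=; first by rewrite -lag1 /= lP.
by rewrite -lag2 /= lP !oE; ring.
Qed.

Lemma mixed_var_lag d u f : mixed_var d (u, f) ->
  mixed_lag d (u, f, gamma ^+ 2 *: (q u - f)).
Proof.
move=> [var1 var2]; split=> [v|g|mu] /=.
- by rewrite -var1 /= semi_innerZl.
- by rewrite -var2 /= !oE; ring.
- by rewrite (semi_innerZl innerX) mulKf ?subrr.
Qed.

Lemma mixed_varP d u f :
  mixed_var d (u, f) <-> exists l, mixed_lag d (u, f, l).
Proof.
split=> [/mixed_var_lag|[l /mixed_lag_var//]].
by move=> h; eexists; exact: h.
Qed.

(** The difference [(w, h)] of two solutions has energy
    [a (ud - ud') (r w) + beta^2 o (fp - fp') h]; by Young's inequality this is at
    most half of the right-hand side plus half of the energy. *)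
Lemma mixed_stability d d' u u' f f' : mixed_var d (u, f) -> mixed_var d' (u', f') ->
  mixed_energy (r u - r u') (q u - q u') (f - f') <=
  a (d.1 - d'.1) (d.1 - d'.1) + beta ^+ 2 * o (d.2 - d'.2) (d.2 - d'.2).
Proof.
move=> [v1 v2] [v1' v2'].
have [w [rw qw]] := lin 1 (-1) u u'.
rewrite !scale1r !scaleN1r in rw qw.
have E : mixed_energy (r w) (q w) (f - f') =
    a (d.1 - d'.1) (r w) + beta ^+ 2 * o (d.2 - d'.2) (f - f').
  have := v1 w; have := v1' w; have /= := v2 (f - f'); have /= := v2' (f - f').
  rewrite !(semi_innerDl innerA) !(semi_innerNl innerA).
  rewrite !(semi_innerDl innerX _ _ (f - f')) !(semi_innerNl innerX _ (f - f')).
  rewrite mulrBr => <- <- <- <-.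
  rewrite /mixed_energy {1}rw {1 3}qw !aE !oE.
  rewrite qw !oE (semi_innerC innerX f' f).
  ring.
rewrite -rw -qw.
have := semi_inner_young innerA (d.1 - d'.1) (r w).
have := semi_inner_young innerX (d.2 - d'.2) (f - f').
move: E; rewrite /mixed_energy.
set ww := a (r w) (r w); set dw := a (d.1 - d'.1) (r w).
set hh := o (f - f') (f - f'); set dh := o (d.2 - d'.2) (f - f').
set dd1 := a (d.1 - d'.1) _; set dd2 := o (d.2 - d'.2) (d.2 - d'.2).
have := semi_inner_ge0 innerX (q w - (f - f')); set pp := o (q w - _) _.
move=> p0 E h1 h2; have b2 : 0 <= beta ^+ 2 := sqr_ge0 _.
have := ler_wpM2l b2 h1; have : 0 <= gamma ^+ 2 * pp by rewrite mulr_ge0// sqr_ge0.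
move: E; lra.
Qed.

(** [q] is onto up to null vectors, [r] is bounded by [q], and [X] is complete. *)
Hypothesis surj : forall x, exists u, o (q u - x) (q u - x) = 0.
Hypothesis bdd : exists C, forall u, a (r u) (r u) <= C * o (q u) (q u).
Hypothesis complX : forall x_, seq_cauchy o x_ -> exists x, seq_cvg o x_ x.

(** Elements of [V] with the same [q] have the same [r], up to null vectors. *)
Lemma mixed_null u v y : o (q u - q v) (q u - q v) = 0 -> a (r u - r v) y = 0.
Proof.
move=> uv0; apply: semi_inner_null innerA _ _ _.
have [w [rw qw]] := lin 1 (-1) u v; rewrite !scale1r !scaleN1r in rw qw.
have [C CP] := bdd; have := CP w; rewrite rw qw uv0 mulr0 => h.
by apply/eqP; rewrite eq_le h semi_inner_ge0.
Qed.

(** With [f] eliminated, the problem is to represent a linear form in the inner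
    product [B x y = a (r (S x)) (r (S y)) + k o x y], where [q (S x) = x]. *)
Lemma mixed_var_exists d : exists s, mixed_var d s.
Proof.
have /choice[S SP] := surj.
have oS x y : o (q (S x)) y = o x y.
  apply/eqP; rewrite -subr_eq0 -(semi_innerNl innerX) -(semi_innerDl innerX).
  by rewrite (semi_inner_null innerX).
have [C0 CP0] := bdd; pose C := `|C0|.
have CP u : a (r u) (r u) <= C * o (q u) (q u).
  by apply: le_trans (CP0 u) _; rewrite ler_wpM2r ?ler_norm// semi_inner_ge0.
pose k := gamma ^+ 2 * beta ^+ 2 / (beta ^+ 2 + gamma ^+ 2).
have bg0 : 0 < beta ^+ 2 + gamma ^+ 2 by rewrite addr_gt0// exprn_gt0.
have k0 : 0 < k by rewrite divr_gt0// mulr_gt0// exprn_gt0.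
have aS (c : R) x y z : a (r (S (c *: x + y))) z = c * a (r (S x)) z + a (r (S y)) z.
  have [w [rw qw]] := lin c 1 (S x) (S y); rewrite !scale1r in rw qw.
  apply/eqP; rewrite -subr_eq0 -(semi_innerZl innerA) -(semi_innerDl innerA) -rw.
  rewrite -(semi_innerNl innerA) -(semi_innerDl innerA); apply/eqP; apply: mixed_null.
  set p := q (S _) - _.
  have p0 z' : o p z' = 0.
    by rewrite /p (semi_innerDl innerX) (semi_innerNl innerX) qw oS
      !(semi_innerDl innerX) !(semi_innerZl innerX) !oS subrr.
  exact: p0.
have aSr (c : R) x y z : a z (r (S (c *: x + y))) = c * a z (r (S x)) + a z (r (S y)).
  by rewrite !(semi_innerC innerA z) aS.
pose B x y := a (r (S x)) (r (S y)) + k * o x y.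
have innerB : semi_inner B.
  split=> [c x y z|x y|x]; rewrite /B.
  - by rewrite aS (semi_innerDl innerX) (semi_innerZl innerX); ring.
  - by rewrite (semi_innerC innerA) (semi_innerC innerX).
  - apply: addr_ge0; first exact: semi_inner_ge0 innerA _.
    exact: mulr_ge0 (ltW k0) (semi_inner_ge0 innerX _).
have B_ge x : k * o x x <= B x x by rewrite /B lerDr (semi_inner_ge0 innerA).
have B_le x : B x x <= (C + k) * o x x.
  rewrite /B mulrDl lerD2r; apply: le_trans (CP _) _.
  by rewrite oS (semi_innerC innerX) oS.
pose l y := a d.1 (r (S y)) + k * o d.2 y.
have [|c x y||x xP] := riesz innerB (l := l).
- move=> x_ cx_; have [|x xP] := complX (x_ := x_).
    move=> e e0; have [N NP] := cx_ (k * e) (mulr_gt0 k0 e0).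
    exists N => m n mN nN; rewrite -(ltr_pM2l k0).
    exact: le_lt_trans (B_ge _) (NP m n mN nN).
  have Ck : 0 < C + k by rewrite ltr_wpDl// normr_ge0.
  exists x => e e0; have [N NP] := xP (e / (C + k)) (divr_gt0 e0 Ck).
  exists N => n nN; apply: le_lt_trans (B_le _) _.
  by rewrite mulrC -ltr_pdivlMr// NP.
- by rewrite /l aSr (semi_innerDr innerX) (semi_innerZr innerX); ring.
- exists (2 * a d.1 d.1 + 2 * k * o d.2 d.2) => y; rewrite /l /B.
  have cs1 := cauchy_schwarz innerA d.1 (r (S y)).
  have cs2 := cauchy_schwarz innerX d.2 y.
  have := semi_inner_ge0 innerA d.1; have := semi_inner_ge0 innerA (r (S y)).
  have := semi_inner_ge0 innerX d.2; have := semi_inner_ge0 innerX y.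
  move: (a d.1 d.1) (a (r (S y)) (r (S y))) (a d.1 (r (S y))) (o d.2 d.2) (o y y)
    (o d.2 y) cs1 cs2 => d1 y1 p1 d2 y2 p2 cs1 cs2 y20 d20 y10 d10.
  have h1 : 0 <= d1 * (k * y2) := mulr_ge0 d10 (mulr_ge0 (ltW k0) y20).
  have h2 : 0 <= k * d2 * y1 := mulr_ge0 (mulr_ge0 (ltW k0) d20) y10.
  have h3 := ler_wpM2l (ltW (mulr_gt0 k0 k0)) cs2.
  have h4 := sqr_ge0 (p1 - k * p2).
  have -> : (2 * d1 + 2 * k * d2) * (y1 + k * y2) = 2 * (d1 * y1) + 2 * (d1 * (k * y2)) +
    2 * (k * d2 * y1) + 2 * (k * k * (d2 * y2)) by ring.
  have -> : (p1 + k * p2) ^+ 2 = 2 * p1 ^+ 2 + 2 * (k * k * p2 ^+ 2) - (p1 - k * p2) ^+ 2 by ring.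
  lra.
pose u := S x.
pose f := (beta ^+ 2 + gamma ^+ 2)^-1 *: (beta ^+ 2 *: d.2 + gamma ^+ 2 *: q u).
have bgn : beta ^+ 2 + gamma ^+ 2 != 0 by rewrite gt_eqF.
exists (u, f); split=> [v|g] /=.
  have rv z : a z (r (S (q v))) = a z (r v).
    apply/eqP; rewrite -subr_eq0 -(semi_innerNr innerA) -(semi_innerDr innerA).
    by rewrite (semi_innerC innerA) mixed_null.
  have := xP (q v); rewrite /B /l !rv -/u -(oS x) -/u /f /k.
  rewrite !oE => h.
  have : a (r u) (r v) = a d.1 (r v) +
      gamma ^+ 2 * beta ^+ 2 / (beta ^+ 2 + gamma ^+ 2) * o d.2 (q v) -
      gamma ^+ 2 * beta ^+ 2 / (beta ^+ 2 + gamma ^+ 2) * o (q u) (q v).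
    by rewrite -h; ring.
  by move=> ->; field.
by rewrite /f !oE; field.
Qed.

End mixed_problem.

(** * The concrete problems *)

(** Lipschitz dependence on the data gives both uniqueness and continuity. *)
Lemma well_posed_lipschitz (R : realType) (D S : Type) (distD : D -> D -> R)
    (eqS : S -> S -> Prop) (distS : S -> S -> R) (sol : D -> S -> Prop) (K : R) :
    0 <= K -> (forall d, distD d d = 0) ->
    (forall d, exists s, sol d s) ->
    (forall d d' s s', sol d s -> sol d' s' -> distS s s' <= K * distD d d') ->
    (forall s s', distS s s' <= 0 -> eqS s s') ->
  well_posed distD eqS distS sol.
Proof.
move=> K0 dd ex lip eq0; split=> // [d s s' ds ds'|d s ds e e0].
  by apply: eq0; have := lip _ _ _ _ ds ds'; rewrite dd mulr0.
have K1 : 0 < K + 1 by rewrite ltr_wpDl.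
exists (e / (K + 1)) => [|d' s' ds' dd']; first exact: divr_gt0.
apply: le_lt_trans (lip _ _ _ _ ds ds') _.
apply: (@le_lt_trans _ _ (K * (e / (K + 1)))); first exact: ler_wpM2l (ltW dd').
by rewrite mulrCA gtr_pMr// ltr_pdivrMr// mul1r ltrDl.
Qed.

Lemma le_sqrtM (R : realType) (x k y : R) : 0 <= x -> 0 <= k -> 0 <= y ->
  x ^+ 2 <= k * y ^+ 2 -> x <= Num.sqrt k * y.
Proof.
move=> x0 k0 y0 h; rewrite -ler_sqr ?nnegrE ?mulr_ge0 ?sqrtr_ge0//.
by rewrite exprMn sqr_sqrtr.
Qed.

(** Bounds on the terms of an energy [x0 + gamma^2 x1 + beta^2 x2], where [x0], [x1],
    [x2], [x3] are the squared norms of [r w], [q w - h], [h], [q w]. *)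
Section energy_bounds.
Context (R : realType) (beta gamma x0 x1 x2 x3 E : R).
Hypotheses (beta_gt0 : 0 < beta) (gamma_gt0 : 0 < gamma)
  (x0_ge0 : 0 <= x0) (x1_ge0 : 0 <= x1) (x2_ge0 : 0 <= x2)
  (le_E : x0 + gamma ^+ 2 * x1 + beta ^+ 2 * x2 <= E).

Lemma energy_bound1 : x1 <= (gamma ^+ 2)^-1 * E.
Proof.
have g2 : 0 < gamma ^+ 2 by rewrite exprn_gt0.
have : 0 <= beta ^+ 2 * x2 by rewrite mulr_ge0// sqr_ge0.
rewrite ler_pdivlMl//; move: le_E x0_ge0; lra.
Qed.

Lemma energy_bound2 : beta ^+ 2 * x2 <= E.
Proof.
have : 0 <= gamma ^+ 2 * x1 by rewrite mulr_ge0// sqr_ge0.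
move: le_E x0_ge0; lra.
Qed.

Lemma energy_bound3 : x3 <= 2 * x1 + 2 * x2 ->
  x0 + beta ^+ 2 * x3 <= (2 + 2 * beta ^+ 2 / gamma ^+ 2) * E.
Proof.
move=> h.
have b2 : 0 <= beta ^+ 2 := sqr_ge0 _.
have h1 := ler_wpM2l b2 energy_bound1.
have h3 := ler_wpM2l b2 h.
have : 0 <= gamma ^+ 2 * x1 by rewrite mulr_ge0// sqr_ge0.
have -> : (2 + 2 * beta ^+ 2 / gamma ^+ 2) * E =
  2 * E + 2 * (beta ^+ 2 * ((gamma ^+ 2)^-1 * E)) by rewrite mulrDl; congr (_ + _); ring.
move: h1 h3 energy_bound2 le_E x0_ge0; lra.
Qed.
End energy_bounds.

Section problems.
Context (R : realType) (n : nat) (Omega Gamma : domain R n) (beta gamma : R).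
Hypotheses (sub_Gamma : (Gamma : set 'rV[R]_n) `<=` Omega)
  (beta_gt0 : 0 < beta) (gamma_gt0 : 0 < gamma) (regular : H2_regular Omega).

Local Notation V := (H20 Omega).
Local Notation data := (L2 Gamma * L2 Omega)%type.

Lemma lebesgue_on_le (S : set 'rV[R]_n) : measurable S ->
  (lebesgue_on Gamma S <= lebesgue_on Omega S)%E.
Proof.
move=> mS; have mD (D : domain R n) : measurable (S `&` D).
  by apply: measurableI => //; exact: rV_open_measurable (@domain_open _ _ D).
by apply: le_measure; rewrite ?inE//; exact: setIS.
Qed.

Lemma Lfun_sub (f : 'rV[R]_n -> R) :
  f \in Lfun (lebesgue_on Omega) 2 -> f \in Lfun (lebesgue_on Gamma) 2.
Proof.
move=> f2; have mf := Lfun_measurable f2.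
apply: Lfun2P => //; apply: (@le_lt_trans _ _ (\int[lebesgue_on Omega]_x (f x * f x)%:E)%E).
  apply: (ge0_le_measure_integral lebesgue_on_le) => //.
    by move=> x; rewrite lee_fin -expr2 sqr_ge0.
  by apply/measurable_EFinP; exact: measurable_funM.
by rewrite -Lfun2_innerE// ltry.
Qed.

Lemma L2_inner_sub (f : 'rV[R]_n -> R) :
  f \in Lfun (lebesgue_on Omega) 2 -> L2_inner Gamma f f <= L2_inner Omega f f.
Proof.
move=> f2; have mf := Lfun_measurable f2.
rewrite -lee_fin /L2_inner !Lfun2_innerE//; last exact: Lfun_sub.
apply: (ge0_le_measure_integral lebesgue_on_le) => //.
  by move=> x; rewrite lee_fin -expr2 sqr_ge0.
by apply/measurable_EFinP; exact: measurable_funM.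
Qed.

(** The restriction to [Gamma].  Elements of [L^2] are functions on the whole space,
    so only the integrability statement changes. *)
Definition restriction (v : V) : L2 Gamma :=
  Lfun_Sub (lee1n 2) (Lfun_sub (LfunP (H2_fun v))).

(** The operator [- lap] on functions with zero trace. *)
Definition neg_lap (v : V) : L2 Omega := - lap v.

(** The inner product of [L2 D], on elements of [L2 D] rather than functions. *)
Definition ip (D : domain R n) (f g : L2 D) : R := L2_inner D f g.

Lemma semi_inner_ip D : semi_inner (@ip D).
Proof. exact: semi_inner_L2. Qed.

Lemma restriction_neg_lap_linear c e (u v : V) : exists w,
  restriction w = c *: restriction u + e *: restriction v /\
  neg_lap w = c *: neg_lap u + e *: neg_lap v.
Proof.
have [w [wE lapE]] := H20_linear c e u v; exists w.
split; apply/LfuneqP => x; first exact: wE.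
transitivity (- lap w x) => //; rewrite lapE.
transitivity (c * - lap u x + e * - lap v x) => //.
by rewrite opprD !mulrN.
Qed.

Lemma ip_eq0 D (f g : L2 D) : f = g %[ae lebesgue_on D] -> ip (f - g) (f - g) = 0.
Proof.
move=> fg; have h0 : ae_eq (lebesgue_on D) setT (f - g : L2 D) (fun=> 0 : R).
  by apply: filterS fg => y /= fgy /fgy e; apply/eqP; rewrite subr_eq0; apply/eqP.
rewrite /ip /L2_inner (inner_ae _ _ _ h0)//.
under eq_Rintegral do rewrite mul0r.
by rewrite Rintegral_cst// mul0r.
Qed.

Lemma ip_eq0P D (f g : L2 D) : ip (f - g) (f - g) = 0 -> f = g %[ae lebesgue_on D].
Proof.
move=> /(inner_eq0 (LfunP _)); apply: filterS => x /= h Dx; apply/eqP.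
by rewrite -subr_eq0; apply/eqP; exact: h.
Qed.

Lemma neg_lap_surj (x : L2 Omega) :
  exists u : V, ip (neg_lap u - x) (neg_lap u - x) = 0.
Proof. by have [C /(_ x)[u [ux _ _]]] := regular; exists u; exact: ip_eq0. Qed.

Lemma neg_lap_inj (u v : V) : neg_lap u = neg_lap v %[ae lebesgue_on Omega] ->
  u = v %[ae lebesgue_on Omega].
Proof.
move=> uv; have [C /(_ (neg_lap v))[w [_ uniq _]]] := regular.
apply: ae_eq_trans (uniq _ uv) _.
by apply: ae_eq_sym; apply: uniq; exact: ae_eq_refl.
Qed.

(** The regularity constant bounds the [H^2] norm, hence the [L^2(Omega)] norm and
    the [L^2(Gamma)] norm, by that of the Laplacian. *)
Lemma restriction_bounded : exists C, forall u : V,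
  ip (restriction u) (restriction u) <= C * ip (neg_lap u) (neg_lap u).
Proof.
have [C CP] := regular; exists (C ^+ 2) => u.
have [w [_ uniq wC]] := CP (neg_lap u).
have uw : u = w %[ae lebesgue_on Omega] by apply: uniq; exact: ae_eq_refl.
apply: le_trans (L2_inner_sub (LfunP (H2_fun u))) _.
have -> : L2_inner Omega (H2_fun u) (H2_fun u) = L2_inner Omega (H2_fun w) (H2_fun w).
  by rewrite /L2_inner (inner_ae _ _ _ uw)// innerC (inner_ae _ _ _ uw).
have -> : ip (neg_lap u) (neg_lap u) = L2_norm Omega (neg_lap u) ^+ 2 by rewrite L2_normK.
have H0 : 0 <= H2_norm w by exact: sqrtr_ge0.
rewrite -exprMn; apply: (@le_trans _ _ (H2_norm w ^+ 2)); last first.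
  by rewrite ler_sqr ?nnegrE// (le_trans H0).
have s1 : 0 <= \sum_i L2_norm Omega (grad w i) ^+ 2.
  by apply: sumr_ge0 => i _; exact: sqr_ge0.
have s2 : 0 <= \sum_i \sum_j L2_norm Omega (hess w i j) ^+ 2.
  by apply: sumr_ge0 => i _; apply: sumr_ge0 => j _; exact: sqr_ge0.
have s0 : 0 <= L2_norm Omega w ^+ 2 by exact: sqr_ge0.
rewrite sqr_sqrtr; last by rewrite addr_ge0// addr_ge0.
by rewrite -L2_normK -addrA lerDl addr_ge0.
Qed.

Local Notation mmin := (mixed_min restriction neg_lap (@ip Gamma) (@ip Omega) beta gamma).
Local Notation mvar := (mixed_var restriction neg_lap (@ip Gamma) (@ip Omega) beta gamma).
Local Notation mlag := (mixed_lag restriction neg_lap (@ip Gamma) (@ip Omega) beta gamma).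

Lemma costE (d : data) v g : cost beta gamma d v g =
  mixed_cost restriction neg_lap (@ip Gamma) (@ip Omega) beta gamma d v g.
Proof. by rewrite /cost !L2_normK. Qed.

Lemma minimizationE d s : minimization beta gamma d s <-> mmin d s.
Proof. by split=> h v g; have := h v g; rewrite !costE. Qed.

Lemma variationalE d s : variational beta gamma d s <-> mvar d s.
Proof. by case: d s => ? ? [? ?]. Qed.

Lemma lagrangianE d s : lagrangian beta gamma d s <-> mlag d s.
Proof. by case: d s => ? ? [[? ?] ?]. Qed.

Lemma ip_young D (p h : L2 D) :
  ip p p <= 2 * ip (p - h) (p - h) + 2 * ip h h.
Proof.
have E := semi_innerE (semi_inner_ip D); have C := semi_innerC (semi_inner_ip D).
have := semi_inner_ge0 (semi_inner_ip D) (p - 2 *: h).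
by rewrite !E (C h p); lra.
Qed.

Lemma L2_norm_ge0 D f : 0 <= L2_norm (D : domain R n) f.
Proof. exact: sqrtr_ge0. Qed.

Lemma G_norm_ge0 (g : L2 Omega) : 0 <= G_norm beta g.
Proof. exact: mulr_ge0 (ltW beta_gt0) (L2_norm_ge0 _ _). Qed.

Lemma M_norm_ge0 (g : L2 Omega) : 0 <= M_norm beta g.
Proof. by apply: mulr_ge0 (L2_norm_ge0 _ _); rewrite invr_ge0 ltW. Qed.

Lemma data_dist_ge0 (d d' : data) : 0 <= data_dist d d'.
Proof. by rewrite addr_ge0// L2_norm_ge0. Qed.

Lemma data_distxx (d : data) : data_dist d d = 0.
Proof.
rewrite /data_dist !subrr.
have h (D : domain R n) : L2_norm D (0 : L2 D) = 0.
  by rewrite /L2_norm -[L2_inner _ _ _]/(ip 0 0) (semi_inner0l (semi_inner_ip D)) sqrtr0.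
by rewrite !h addr0.
Qed.

Let energy := mixed_energy (@ip Gamma) (@ip Omega) beta gamma.

Lemma energy_le (d d' : data) u u' f f' : mvar d (u, f) -> mvar d' (u', f') ->
  energy (restriction u - restriction u') (neg_lap u - neg_lap u') (f - f') <=
  (1 + beta ^+ 2) * data_dist d d' ^+ 2.
Proof.
move=> h h'; apply: le_trans
  (mixed_stability (semi_inner_ip _) (semi_inner_ip _) restriction_neg_lap_linear h h') _.
have -> : ip (d.1 - d'.1) (d.1 - d'.1) = L2_norm Gamma (d.1 - d'.1) ^+ 2 by rewrite L2_normK.
have -> : ip (d.2 - d'.2) (d.2 - d'.2) = L2_norm Omega (d.2 - d'.2) ^+ 2 by rewrite L2_normK.
rewrite /data_dist; move: (L2_norm_ge0 Gamma (d.1 - d'.1)) (L2_norm_ge0 Omega (d.2 - d'.2)).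
move: (L2_norm Gamma _) (L2_norm Omega _) => x y x0 y0.
have hx : x ^+ 2 <= (x + y) ^+ 2 by rewrite ler_sqr ?nnegrE ?addr_ge0// lerDl.
have hy : y ^+ 2 <= (x + y) ^+ 2 by rewrite ler_sqr ?nnegrE ?addr_ge0// lerDr.
rewrite mulrDl mul1r; apply: lerD hx _.
exact: (ler_wpM2l (sqr_ge0 beta) hy).
Qed.

(** The squares of the Lipschitz constants of [f], of [u] and of the multiplier, each
    in the norm of its space. *)
Let c := 1 + beta ^+ 2.
Let cV := (2 + 2 * beta ^+ 2 / gamma ^+ 2) * c.
Let cM := gamma ^+ 2 / beta ^+ 2 * c.

Let c_ge0 : 0 <= c. Proof. by rewrite addr_ge0// sqr_ge0. Qed.
Let cV_ge0 : 0 <= cV.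
Proof.
apply: mulr_ge0 c_ge0; apply: addr_ge0; first exact: (ler0n R 2).
by apply: divr_ge0; [apply: mulr_ge0; [exact: (ler0n R 2)|exact: sqr_ge0]|exact: sqr_ge0].
Qed.
Let cM_ge0 : 0 <= cM. Proof. by apply: mulr_ge0 c_ge0; apply: divr_ge0; exact: sqr_ge0. Qed.

Lemma V_distK (u v : V) : V_dist Gamma beta u v ^+ 2 =
  ip (restriction u - restriction v) (restriction u - restriction v) +
  beta ^+ 2 * ip (neg_lap u - neg_lap v) (neg_lap u - neg_lap v).
Proof.
rewrite sqr_sqrtr; last first.
  by apply: addr_ge0; [|apply: mulr_ge0]; exact: sqr_ge0.
rewrite !L2_normK; congr (_ + _ * _); apply: eq_Rintegral => x _.
transitivity ((lap u x - lap v x) * (lap u x - lap v x)) => //.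
transitivity ((- lap u x - - lap v x) * (- lap u x - - lap v x)) => //.
by ring.
Qed.

Lemma VG_dist_le (d d' : data) s s' : mvar d s -> mvar d' s' ->
  VG_dist Gamma beta s s' <= (Num.sqrt cV + Num.sqrt c) * data_dist d d'.
Proof.
case: s s' => [u f] [u' f'] h h'; rewrite mulrDl.
have E := energy_le h h'; rewrite /energy /mixed_energy -/c in E.
have D0 := data_dist_ge0 d d'.
have ge0 D := semi_inner_ge0 (semi_inner_ip D).
apply: lerD; apply: le_sqrtM => //.
- exact: sqrtr_ge0.
- rewrite V_distK /cV -mulrA; apply: energy_bound3 (ip_young _ (f - f')) => //; exact: ge0.
- exact: G_norm_ge0.
- rewrite exprMn L2_normK; apply: energy_bound2 E => //; exact: ge0.
Qed.

Lemma VGM_dist_le (d d' : data) s s' : mlag d s -> mlag d' s' ->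
  VGM_dist Gamma beta s s' <=
    (Num.sqrt cV + Num.sqrt c + Num.sqrt cM) * data_dist d d'.
Proof.
case: s s' => [[u f] l] [[u' f'] l'] h h'; rewrite mulrDl.
have hv := mixed_lag_var (semi_inner_ip Omega) gamma_gt0 h.
have hv' := mixed_lag_var (semi_inner_ip Omega) gamma_gt0 h'.
apply: lerD; first exact: VG_dist_le.
have E := energy_le hv hv'; rewrite /energy /mixed_energy -/c in E.
have ge0 D := semi_inner_ge0 (semi_inner_ip D).
apply: le_sqrtM => //.
- exact: M_norm_ge0.
- exact: data_dist_ge0.
rewrite exprMn L2_normK -[L2_inner _ _ _]/(ip (l - l') (l - l')).
have lE := mixed_lag_multiplier gamma_gt0 h; have lE' := mixed_lag_multiplier gamma_gt0 h'.
have -> : ip (l - l') (l - l') = gamma ^+ 2 * (gamma ^+ 2 *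
    ip (neg_lap u - neg_lap u' - (f - f')) (neg_lap u - neg_lap u' - (f - f'))).
  have oE := semi_innerE (semi_inner_ip Omega).
  have oC := semi_innerC (semi_inner_ip Omega).
  have lP mu : ip (l - l') mu =
      gamma ^+ 2 * ip (neg_lap u - neg_lap u' - (f - f')) mu.
    by rewrite (semi_innerDl (semi_inner_ip Omega)) (semi_innerNl (semi_inner_ip Omega))
      lE lE' !oE; ring.
  by rewrite lP oC lP.
have := energy_bound1 gamma_gt0 (ge0 _ _) (ge0 _ _) E.
rewrite -ler_pdivrMl ?invr_gt0 ?exprn_gt0// invrK => le1.
rewrite /cM -mulrA mulrCA mulrA exprVn.
by apply: ler_wpM2l le1; apply: divr_ge0; exact: sqr_ge0.
Qed.

Lemma V_dist_ge0 (u v : V) : 0 <= V_dist Gamma beta u v.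
Proof. exact: sqrtr_ge0. Qed.

Lemma VG_dist_eq (s s' : V * L2 Omega) :
  VG_dist Gamma beta s s' <= 0 -> VG_eq s s'.
Proof.
case: s s' => [u f] [u' f'] h.
have h1 := V_dist_ge0 u u'.
have h2 := G_norm_ge0 (f - f').
move: h; rewrite /VG_dist /= => h.
have /eqP : V_dist Gamma beta u u' = 0 by apply/eqP; rewrite eq_le h1 andbT; move: h2 h; lra.
have /eqP : G_norm beta (f - f') = 0 by apply/eqP; rewrite eq_le h2 andbT; move: h1 h; lra.
rewrite -sqrf_eq0 exprMn L2_normK mulf_eq0 sqrf_eq0 gt_eqF//= => /eqP f0.
rewrite -sqrf_eq0 V_distK.
have ge0 D := semi_inner_ge0 (semi_inner_ip D).
rewrite paddr_eq0; [|exact: ge0|apply: mulr_ge0; [exact: sqr_ge0|exact: ge0]].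
move=> /andP[_].
rewrite mulf_eq0 sqrf_eq0 gt_eqF//= => /eqP q0.
split; last exact: ip_eq0P.
by apply: neg_lap_inj; exact: ip_eq0P.
Qed.

Lemma VGM_dist_eq (s s' : V * L2 Omega * L2 Omega) :
  VGM_dist Gamma beta s s' <= 0 -> VGM_eq s s'.
Proof.
case: s s' => [s l] [s' l']; rewrite /VGM_dist /= => h.
have h1 : 0 <= VG_dist Gamma beta s s'.
  by apply: addr_ge0; [exact: V_dist_ge0|exact: G_norm_ge0].
have h2 := M_norm_ge0 (l - l').
have /eqP : M_norm beta (l - l') = 0 by apply/eqP; rewrite eq_le h2 andbT; move: h1 h; lra.
rewrite -sqrf_eq0 exprMn L2_normK mulf_eq0 sqrf_eq0 invr_eq0 gt_eqF//= => /eqP l0.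
split; last exact: ip_eq0P.
by apply: VG_dist_eq; move: h2 h; lra.
Qed.

Lemma variational_exists (d : data) : exists s, mvar d s.
Proof.
apply: mixed_var_exists; [exact: semi_inner_ip|exact: semi_inner_ip|exact: beta_gt0|
  exact: gamma_gt0|exact: restriction_neg_lap_linear|exact: neg_lap_surj|
  exact: restriction_bounded|].
by move=> x_; exact: riesz_fischer.
Qed.

Lemma minimizationP (d : data) s :
  minimization beta gamma d s <-> variational beta gamma d s.
Proof.
rewrite minimizationE variationalE; apply: mixed_minP => //;
  [exact: semi_inner_ip|exact: semi_inner_ip|exact: restriction_neg_lap_linear].
Qed.

Lemma variationalP (d : data) s :
  variational beta gamma d s <-> exists l, lagrangian beta gamma d (s, l).
Proof.
rewrite variationalE; case: s => u f; rewrite mixed_varP//; last exact: semi_inner_ip.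
by split=> -[l /lagrangianE h]; exists l.
Qed.

Lemma variational_well_posed : well_posed (@data_dist R n Omega Gamma)
  (@VG_eq R n Omega) (@VG_dist R n Omega Gamma beta)
  (@variational R n Omega Gamma beta gamma).
Proof.
apply: (well_posed_lipschitz (K := Num.sqrt cV + Num.sqrt c)).
- by rewrite addr_ge0// sqrtr_ge0.
- exact: data_distxx.
- by move=> d; have [s /variationalE] := variational_exists d; exists s.
- by move=> d d' s s' /variationalE h /variationalE h'; exact: VG_dist_le.
- exact: VG_dist_eq.
Qed.

Lemma minimization_well_posed : well_posed (@data_dist R n Omega Gamma)
  (@VG_eq R n Omega) (@VG_dist R n Omega Gamma beta)
  (@minimization R n Omega Gamma beta gamma).
Proof.
have [ex uniq cont] := variational_well_posed; split=> [d|d s s'|d s].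
- by have [s /minimizationP] := ex d; exists s.
- by move=> /minimizationP h /minimizationP; exact: uniq.
- move=> /minimizationP h e e0; have [delta delta0 dP] := cont d s h e e0.
  by exists delta => // d' s' /minimizationP; exact: dP.
Qed.

Lemma lagrangian_well_posed : well_posed (@data_dist R n Omega Gamma)
  (@VGM_eq R n Omega) (@VGM_dist R n Omega Gamma beta)
  (@lagrangian R n Omega Gamma beta gamma).
Proof.
apply: (well_posed_lipschitz (K := Num.sqrt cV + Num.sqrt c + Num.sqrt cM)).
- by rewrite !addr_ge0// sqrtr_ge0.
- exact: data_distxx.
- move=> d; have [[u f] /variationalE /variationalP[l ?]] := variational_exists d.
  by exists (u, f, l).
- by move=> d d' s s' /lagrangianE h /lagrangianE h'; exact: VGM_dist_le.
- exact: VGM_dist_eq.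
Qed.

End problems.

Theorem theorem2 (R : realType) (n : nat) (Omega Gamma : domain R n)
    (bounded_Omega : bounded_set (Omega : set 'rV[R]_n))
    (proper_Gamma : (Gamma : set 'rV[R]_n) `<` Omega)
    (beta gamma : R) (beta_gt0 : 0 < beta) (gamma_gt0 : 0 < gamma)
    (gammaV_lt_beta : 1 / gamma < beta)
    (regular_Omega : H2_regular Omega) :
  [/\ well_posed (@data_dist R n Omega Gamma)
        (@VG_eq R n Omega) (@VG_dist R n Omega Gamma beta)
        (@minimization R n Omega Gamma beta gamma),
      well_posed (@data_dist R n Omega Gamma)
        (@VG_eq R n Omega) (@VG_dist R n Omega Gamma beta)
        (@variational R n Omega Gamma beta gamma),
      well_posed (@data_dist R n Omega Gamma)
        (@VGM_eq R n Omega) (@VGM_dist R n Omega Gamma beta)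
        (@lagrangian R n Omega Gamma beta gamma),
      forall (d : L2 Gamma * L2 Omega) (s : H20 Omega * L2 Omega),
        minimization beta gamma d s <-> variational beta gamma d s &
      forall (d : L2 Gamma * L2 Omega) (s : H20 Omega * L2 Omega),
        variational beta gamma d s <->
        exists lambda : L2 Omega, lagrangian beta gamma d (s, lambda)].
Proof.
have [sub_Gamma _] := proper_Gamma; split.
- exact: minimization_well_posed.
- exact: variational_well_posed.
- exact: lagrangian_well_posed.
- by move=> d s; exact: minimizationP.
- by move=> d s; exact: variationalP.
Qed.
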